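(* Let $X$ be an infinite Riemann surface equipped with its conformal hyperbolic metric and let $\lambda$ be a geodesic lamination contained in the convex core $\mathcal{C}(X)$ of $X$. Then $\lambda$ is nowhere dense in $X$. In particular, if $X=\mathcal{C}(X)$ then any geodesic lamination $\lambda$ in $X$ is nowhere dense.
   Context: A Riemann surface $X$ is infinite if $\pi_1(X)$ is infinitely generated; it then carries a unique complete conformal hyperbolic metric (curvature $-1$), and its universal covering $\tilde X$ is isometric to the hyperbolic plane, with ideal boundary circle $\partial_\infty\tilde X$; $\pi_1(X)$ acts on $\tilde X$ by isometries with $X=\tilde X/\pi_1(X)$. Let $\Lambda(\pi_1(X))\subset\partial_\infty\tilde X$ be the limit set of $\pi_1(X)$ and $\mathcal{C}(\Lambda(\pi_1(X)))\subset\tilde X$ its convex core, i.e. the smallest convex subset of $\tilde X$ having $\Lambda(\pi_1(X))$ as ideal boundary. The convex core of $X$ is $\mathcal{C}(X)=\mathcal{C}(\Lambda(\pi_1(X)))/\pi_1(X)$. A geodesic lamination $\lambda$ on $X$ is a closed subset of $X$ together with a foliation of it by simple, pairwise disjoint, complete geodesics of $X$; that is, the closed subset is decomposed into such geodesics and each of its points has a neighborhood (in the subset) homeomorphic to $T\times I$, where $T$ is homeomorphic to a closed subset of a compact geodesic arc and $I$ is an open interval, the slices $\{t\}\times I$ corresponding to open arcs on the geodesics. *)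

(* Defs.v *)
From HB Require Import structures.
From mathcomp Require Import all_boot all_order all_algebra.
From mathcomp Require Import all_classical all_reals all_analysis.
From mathcomp Require Import complex.
Set Implicit Arguments.
Unset Strict Implicit.
Unset Printing Implicit Defensive.
Import Order.TTheory GRing.Theory Num.Theory.
Import numFieldNormedType.Exports.
Local Open Scope classical_set_scope.
Local Open Scope ring_scope.

Definition nowhere_dense (X : topologicalType) (A : set X) : Prop :=
  interior (closure A) = set0.

Definition homeomorphism_on (S T : topologicalType) (A : set S) (B : set T)
    (f : S -> T) : Prop :=
  exists g : T -> S,
    [/\ set_fun A B f, set_fun B A g,
        {in A, cancel f g} /\ {in B, cancel g f},
        {within A, continuous f} & {within B, continuous g}].

Definition covering_map (S T : topologicalType) (p : S -> T) : Prop :=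
  [/\ continuous p, range p = setT &
      forall x : T, exists U : set T, exists sheets : set (set S),
        [/\ open_nbhs x U,
            forall V, sheets V -> open V /\ homeomorphism_on V U p,
            forall V W, sheets V -> sheets W -> V `&` W !=set0 -> V = W &
            p @^-1` U = \bigcup_(V in sheets) V]].

Section TransformationGroups.
Variable T : Type.

Definition transformation_group (G : set (T -> T)) : Prop :=
  [/\ G id, forall g h, G g -> G h -> G (g \o h) &
      forall g h, G g -> cancel g h -> cancel h g -> G h].

Definition finitely_generated (G : set (T -> T)) : Prop :=
  exists S : set (T -> T),
    [/\ finite_set S, S `<=` G & G `<=` smallest transformation_group S].

End TransformationGroups.

Section RiemannSurfaces.
Variable R : realType.

(* [R[i]^o] carries the topology of the complex norm, and [derivable f z 1]
   over the scalars [R[i]] is complex differentiability. *)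
Local Notation C := (R[i]^o).

Definition holomorphic_at (f : C -> C) (z : C) : Prop :=
  \forall w \near z, derivable f w 1.

Record riemannSurface := RiemannSurface {
  rs_space :> topologicalType;
  rs_atlas : set (set rs_space * (rs_space -> C));
  rs_hausdorff : hausdorff_space rs_space;
  rs_connected : connected [set: rs_space];
  rs_chart : forall U phi, rs_atlas (U, phi) ->
    [/\ open U, open (phi @` U) & homeomorphism_on U (phi @` U) phi];
  rs_cover : forall x, exists U phi, rs_atlas (U, phi) /\ U x;
  rs_transition : forall U phi V psi x,
    rs_atlas (U, phi) -> rs_atlas (V, psi) -> U x -> V x ->
    exists f : C -> C, holomorphic_at f (phi x) /\
      \forall y \near x, psi y = f (phi y)
}.

(* The Poincare disk model of the hyperbolic plane. *)
Definition hplane : topologicalType := set_type [set z : C | `|z| < 1].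

Definition hval (z : hplane) : C := set_val z.

Definition cabs (z : C) : R := complex.Re `|z|.

(* The distance 2 artanh (|z - w| / |1 - z^* w|) of the metric
   4 |dz|^2 / (1 - |z|^2)^2, which has curvature -1. *)
Definition hdist (z w : hplane) : R :=
  let a := cabs (1 - (hval z)^*%C * hval w) in
  let b := cabs (hval z - hval w) in
  ln ((a + b) / (a - b)).

(* The conformal automorphisms of the disk, i.e. the orientation-preserving
   isometries of [hdist], as elements of PSU(1,1). *)
Definition disk_isometry (g : hplane -> hplane) : Prop :=
  exists a b : C, `|a| ^+ 2 - `|b| ^+ 2 = 1 /\
    forall z, hval (g z) = (a * hval z + b) / (b^*%C * hval z + a^*%C).

Definition geodesic_line (gam : R -> hplane) : Prop :=
  forall s t, hdist (gam s) (gam t) = `|s - t|.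

Definition hconvex (K : set hplane) : Prop :=
  forall gam s t u, geodesic_line gam -> s <= u <= t ->
    K (gam s) -> K (gam t) -> K (gam u).

(* The trace at infinity of K: its limit points on the unit circle. *)
Definition ideal_boundary (K : set hplane) : set C :=
  [set z | `|z| = 1] `&` closure (hval @` K).

Definition limit_set (G : set (hplane -> hplane)) : set C :=
  \bigcup_(z : hplane) ideal_boundary [set g z | g in G].

(* The smallest closed convex set with ideal boundary L. Without closedness
   there is in general no smallest convex set: already for two ideal points,
   open regions adjacent to the geodesic on either of its sides compete. *)
Definition convex_hull (L : set C) : set hplane :=
  smallest (fun K => [/\ closed K, hconvex K & ideal_boundary K = L]) set0.

Section HyperbolicSurface.
Variables (X : riemannSurface) (p : hplane -> X).

Definition holomorphic_to_surface : Prop :=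
  forall z U phi, rs_atlas (U, phi) -> U (p z) ->
    exists f : C -> C, holomorphic_at f (hval z) /\
      \forall w \near z, phi (p w) = f (hval w).

(* The fundamental group of X, acting on the universal covering. *)
Definition deck_group : set (hplane -> hplane) :=
  [set g | disk_isometry g /\ p \o g = p].

(* The conformal hyperbolic metric of X is given by the holomorphic universal
   covering p by the hyperbolic plane, of which it is the quotient metric:
   the fibers of p are the orbits of the fundamental group. *)
Definition hyperbolic_universal_covering : Prop :=
  [/\ covering_map p, holomorphic_to_surface &
      forall z w, p z = p w -> exists2 g, deck_group g & g z = w].

Definition infinite_surface : Prop := ~ finitely_generated deck_group.

Definition convex_core : set X :=
  p @` convex_hull (limit_set deck_group).

Definition complete_geodesic (c : R -> X) : Prop :=
  exists2 gam, geodesic_line gam & c = p \o gam.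

(* A simple geodesic either never returns or is closed and simple. *)
Definition simple_curve (c : R -> X) : Prop :=
  injective c \/
  exists2 T : R, 0 < T &
    forall s t, c s = c t <-> exists k : int, t = s + k%:~R * T.

Definition open_arc_of (l A : set X) : Prop :=
  exists c s0 s1, [/\ complete_geodesic c, range c = l, s0 < s1,
    {in `]s0, s1[ &, injective c} & A = c @` `]s0, s1[].

(* The transversal T is a closed subset of a compact geodesic arc, which is
   parametrized by a compact interval. *)
Record geodesic_lamination := GeodesicLamination {
  gl_support :> set X;
  gl_leaves : set (set X);
  gl_closed : closed gl_support;
  gl_geodesic : forall l, gl_leaves l ->
    exists c, [/\ complete_geodesic c, simple_curve c & l = range c];
  gl_disjoint : forall l m, gl_leaves l -> gl_leaves m ->
    l `&` m !=set0 -> l = m;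
  gl_union : gl_support = \bigcup_(l in gl_leaves) l;
  gl_product : forall x, gl_support x ->
    exists (N : set X) (a b : R) (T : set R) (f : R * R -> X),
      [/\ N `<=` gl_support, within gl_support (nbhs x) N,
          closed T /\ T `<=` `[a, b],
          homeomorphism_on (T `*` (`]0, 1[ : set R)) N f &
          forall t, T t -> exists2 l, gl_leaves l &
            open_arc_of l (f @` ([set t] `*` (`]0, 1[ : set R)))]
}.

End HyperbolicSurface.
End RiemannSurfaces.

(* Main.v *)
(* In the hyperboloid model a point of the disk is a positive definite quadratic
   form of determinant 1 on the plane, an ideal point is a nonzero vector up to
   scaling, and the geodesic with endpoints [p], [q] consists of the forms for
   which [p] and [q] are orthogonal. The covering group acts by unimodular
   matrices.

   Suppose that the lift of the lamination contains a neighborhood of a point.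
   The leaves crossing a small transversal of the leaf through that point do not
   cross each other; in the upper half plane, with the transversal on the
   imaginary axis, they join [x u] to [- y u] where [x u * y u = u ^ 2], and [x],
   [y] are monotone, hence continuous. So one of them, say [x], sweeps out an
   interval of ideal points. All of these are limit points, because the leaves
   lie in the convex core. Hence two given points can be moved by the same covering
   transformation arbitrarily close to an interior point of the interval; the
   leaves through their images belong to the sweep, and their cross ratio
   degenerates. As cross ratios are invariant, any two leaves share an endpoint.
   Therefore [y] is constant and all leaves end at one point [eta], which is fixed
   by the covering group. With [eta] at infinity, the group consists of affine maps,
   and accumulates at two different points of the real line: this produces a
   translation and arbitrarily strong contractions, contradicting discreteness. *)
Require Import Defs.
From mathcomp Require Import all_boot all_order all_algebra.
From mathcomp Require Import all_classical all_reals all_analysis.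
From mathcomp Require Import complex ring lra.
Set Implicit Arguments.
Unset Strict Implicit.
Unset Printing Implicit Defensive.
Import Order.TTheory GRing.Theory Num.Theory.
Import numFieldNormedType.Exports.
Local Open Scope ring_scope.
Local Open Scope classical_set_scope.

(** * Quadratic forms and noncrossing systems of geodesics *)

Definition det2 (R : realType) (p q : R * R) : R := p.1 * q.2 - p.2 * q.1.

Definition bil (R : realType) (X : R * R * R) (p q : R * R) : R :=
  X.1.1 * p.1 * q.1 + X.1.2 * (p.1 * q.2 + p.2 * q.1) + X.2 * p.2 * q.2.

Definition lmap (R : realType) (m1 m2 p : R * R) : R * R :=
  (p.1 * m1.1 + p.2 * m2.1, p.1 * m1.2 + p.2 * m2.2).

(* Polarization of twice the determinant; [2 cosh] of the hyperbolic distance on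
   forms of determinant 1. *)
Definition pol (R : realType) (X Y : R * R * R) : R :=
  X.1.1 * Y.2 + X.2 * Y.1.1 - 2 * X.1.2 * Y.1.2.

Definition pullback (R : realType) (n1 n2 : R * R) (X : R * R * R) : R * R * R :=
  (bil X n1 n1, bil X n1 n2, bil X n2 n2).

(* [S z] is the quadratic form of the point [z], [Lf p q] says that there is a leaf
   with ideal endpoints [p] and [q], and [bil (S z) p q = 0] that [z] lies on it;
   [det2 p r * det2 q s * (det2 p s * det2 q r) < 0] iff the geodesics from [p] to
   [q] and from [r] to [s] cross. [ns_limit] says that orbits accumulate at [p]. *)
Record noncrossing_system (R : realType) (H : Type) (S : H -> R * R * R)
    (Lf : R * R -> R * R -> Prop) (G : set (H -> H)) : Prop := NoncrossingSystem {
  ns_pos : forall z, 0 < (S z).1.1;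
  ns_det : forall z, (S z).1.1 * (S z).2 - (S z).1.2 ^+ 2 = 1;
  ns_neq : forall p q, Lf p q -> det2 p q != 0;
  ns_sym : forall p q, Lf p q -> Lf q p;
  ns_scale : forall k p q, k != 0 -> Lf p q -> Lf (k * p.1, k * p.2) q;
  ns_cross : forall p q r s, Lf p q -> Lf r s ->
    0 <= det2 p r * det2 q s * (det2 p s * det2 q r);
  ns_point : forall p q, Lf p q -> exists z, bil (S z) p q = 0;
  ns_comp : forall g h, G g -> G h -> G (g \o h);
  ns_inv : forall g, G g -> exists h, [/\ G h, cancel g h & cancel h g];
  ns_act : forall g, G g -> exists m1 m2, [/\ det2 m1 m2 = 1,
    forall z p q, bil (S (g z)) p q = bil (S z) (lmap m1 m2 p) (lmap m1 m2 q) &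
    forall p q, Lf p q -> Lf (lmap m1 m2 p) (lmap m1 m2 q)];
  ns_limit : forall p q z1 z2 e, Lf p q -> 0 < e -> exists g, [/\ G g,
    bil (S (g z1)) p p <= e * bil (S (g z1)) q q &
    bil (S (g z2)) p p <= e * bil (S (g z2)) q q];
  ns_discrete : forall z0, exists2 e, 0 < e &
    forall g, G g -> pol (S (g z0)) (S z0) < 2 + e -> g z0 = z0
}.

Lemma ns_pos2 (R : realType) (H : Type) (S : H -> R * R * R) Lf G
  (ns : noncrossing_system S Lf G) z : 0 < (S z).2.
Proof.
have := ns_pos ns z; have := ns_det ns z.
move: (S z) => [[a b] c] /= h1 h2.
have : 0 < a * c by nra.
by rewrite pmulr_rgt0.
Qed.

Lemma bil_pullback (R : realType) (n1 n2 : R * R) X p q :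
  bil (pullback n1 n2 X) p q = bil X (lmap n1 n2 p) (lmap n1 n2 q).
Proof. by rewrite /pullback /bil /lmap /=; ring. Qed.

Lemma det2_lmap (R : realType) (n1 n2 p q : R * R) :
  det2 (lmap n1 n2 p) (lmap n1 n2 q) = det2 n1 n2 * det2 p q.
Proof. by rewrite /det2 /lmap /=; ring. Qed.

Lemma lmap_scale (R : realType) (n1 n2 p : R * R) k :
  lmap n1 n2 (k * p.1, k * p.2) = (k * (lmap n1 n2 p).1, k * (lmap n1 n2 p).2).
Proof. by rewrite /lmap /=; congr pair; ring. Qed.

Lemma bil_pos (R : realType) (X : R * R * R) p :
  0 < X.1.1 -> 0 < X.1.1 * X.2 - X.1.2 ^+ 2 -> p != (0, 0) -> 0 < bil X p p.
Proof.
case: X p => [[a b] c] [x y] /= a0 d0 p0.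
rewrite -(pmulr_rgt0 _ a0) /bil /=.
have -> : a * (a * x * x + b * (x * y + y * x) + c * y * y) =
   (a * x + b * y) ^+ 2 + (a * c - b ^+ 2) * y ^+ 2 by ring.
have [y0|y0] := eqVneq y 0.
  have x0 : x != 0 by apply: contra_neq p0 => ->; rewrite y0.
  by rewrite y0 expr0n /= !mulr0 !addr0 exprn_even_gt0 //= mulf_neq0 // gt_eqF.
by rewrite ltr_wpDl ?sqr_ge0// mulr_gt0// exprn_even_gt0.
Qed.

Definition inv_lmap (R : realType) (n1 n2 v : R * R) : R * R :=
  (det2 v n2 / det2 n1 n2, det2 n1 v / det2 n1 n2).

Lemma inv_lmapK (R : realType) (n1 n2 v : R * R) : det2 n1 n2 != 0 ->
  lmap n1 n2 (inv_lmap n1 n2 v) = v.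
Proof. by case: n1 n2 v => [a b] [c d] [x y]; rewrite /lmap /inv_lmap /det2 /= => h; congr pair; field. Qed.

(** All data are invariant under a change of basis: covering matrices are conjugated, and the
    crossing product is scaled by the fourth power of the determinant. Determinant -1 is included so
    that reflections are available. *)
Lemma ns_pullback (R : realType) (H : Type) (S : H -> R * R * R) Lf G n1 n2 :
  det2 n1 n2 ^+ 2 = 1 -> noncrossing_system S Lf G ->
  noncrossing_system (fun z => pullback n1 n2 (S z))
    (fun p q => Lf (lmap n1 n2 p) (lmap n1 n2 q)) G.
Proof.
move=> dn ns.
have dn0 : det2 n1 n2 != 0.
  by apply/eqP => d0; move: dn; rewrite d0 expr0n /= => /eqP; rewrite eq_sym oner_eq0.
have pb_det X : (bil X n1 n1) * (bil X n2 n2) - (bil X n1 n2) ^+ 2 =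
    det2 n1 n2 ^+ 2 * (X.1.1 * X.2 - X.1.2 ^+ 2).
  by rewrite /bil /det2; ring.
split => /=.
- move=> z; apply: bil_pos; rewrite ?(ns_pos ns) ?(ns_det ns) //.
  by apply: contra_neq dn0 => ->; rewrite /det2 /= !mul0r subr0.
- by move=> z; rewrite pb_det (ns_det ns) dn mulr1.
- by move=> p q /(ns_neq ns); rewrite det2_lmap mulf_eq0 negb_or => /andP[].
- by move=> p q /(ns_sym ns).
- by move=> k p q k0 /(ns_scale ns k0); rewrite lmap_scale.
- move=> p q r s l1 l2; have := ns_cross ns l1 l2; rewrite !det2_lmap.
  set D := det2 n1 n2; set a := det2 p r; set b := det2 q s.
  set c := det2 p s; set d := det2 q r.
  have -> : D * a * (D * b) * (D * c * (D * d)) = (D ^+ 2) ^+ 2 * (a * b * (c * d)) by ring.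
  by rewrite dn expr1n mul1r.
- by move=> p q /(ns_point ns)[z hz]; exists z; rewrite bil_pullback.
- exact: ns_comp ns.
- exact: ns_inv ns.
- move=> g /(ns_act ns)[m1 [m2 [dm hm Lm]]].
  pose k1 := inv_lmap n1 n2 (lmap m1 m2 n1); pose k2 := inv_lmap n1 n2 (lmap m1 m2 n2).
  have kE p : lmap n1 n2 (lmap k1 k2 p) = lmap m1 m2 (lmap n1 n2 p).
    have -> : lmap n1 n2 (lmap k1 k2 p) =
        lmap (lmap n1 n2 k1) (lmap n1 n2 k2) p.
      by rewrite /lmap /=; congr pair; ring.
    by rewrite !inv_lmapK // /lmap /=; congr pair; ring.
  exists k1, k2; split.
  + have := det2_lmap n1 n2 k1 k2; rewrite !inv_lmapK // det2_lmap dm mul1r.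
    by move=> h; apply: (mulfI dn0); rewrite mulr1.
  + by move=> z p q; rewrite !bil_pullback hm !kE.
  + by move=> p q /Lm; rewrite !kE.
- move=> p q z1 z2 e l e0; have [g [Gg h1 h2]] := ns_limit ns z1 z2 l e0.
  by exists g; rewrite !bil_pullback.
- move=> z0; have [e e0 he] := ns_discrete ns z0; exists e => // g Gg.
  have -> : pol (pullback n1 n2 (S (g z0))) (pullback n1 n2 (S z0)) =
     det2 n1 n2 ^+ 2 * pol (S (g z0)) (S z0) by rewrite /pol /pullback /bil /det2 /=; ring.
  by rewrite dn mul1r; exact: he.
Qed.

(** * Groups with a common fixed ideal point *)

(* The commutator of two contractions with different fixed points is a
   translation; conjugating it by strong contractions contradicts discreteness. *)
Lemma affine_group_not_discrete (R : realType) (H : Type) (m h : H -> R)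
    (G : set (H -> H)) (z0 : H) (t1 t2 e : R) :
  (forall z, 0 < h z) ->
  (forall f g, G f -> G g -> G (f \o g)) ->
  (forall g, G g -> exists f, [/\ G f, cancel g f & cancel f g]) ->
  (forall g, G g -> exists k t, [/\ 0 < k, forall z, m (g z) = k * m z + t &
     forall z, h (g z) = k * h z]) ->
  (forall d t, 0 < d -> t = t1 \/ t = t2 -> exists g, [/\ G g,
     `|m (g z0) - t| < d & h (g z0) < d]) ->
  t1 != t2 -> 0 < e ->
  ~ (forall g, G g -> `|m (g z0) - m z0| < e -> h (g z0) = h z0 -> m (g z0) = m z0).
Proof.
move=> h0 Gc Gi Ga near t12 e0 disc.
have hz := h0 z0.
have [g1 [G1 _ h1]] := near _ t1 hz (or_introl erefl).
have [k1 [s1 [k1p m1E h1E]]] := Ga _ G1.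
have k1lt : k1 < 1 by move: h1; rewrite h1E -ltr_pdivlMr // divff // gt_eqF.
(* [c] is the fixed point of the contraction [g1] on the real line. *)
pose c := s1 / (1 - k1).
have s1E : s1 = c * (1 - k1) by rewrite /c mulfVK // subr_eq0 gt_eqF.
have [t [tt tc]] : exists t, (t = t1 \/ t = t2) /\ c != t.
  have [ct|ct] := eqVneq c t1; last by exists t1; split; [left|].
  by exists t2; split; [right|rewrite ct].
pose K := 1 + (`|c| + `|m z0|) / h z0.
have Kp : 0 < K by rewrite ltr_pwDl // divr_ge0 // ?addr_ge0 // ltW.
have ctp : 0 < `|c - t| by rewrite normr_gt0 subr_eq0.
have [g2 [G2 m2 h2]] := near (`|c - t| / K) t (divr_gt0 ctp Kp) tt.
have [k2 [s2 [k2p m2E h2E]]] := Ga _ G2.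
(* The difference of the translation parts of [g1 \o g2] and [g2 \o g1]. It vanishes only if [g2]
   also fixes [c]; by the choice of [K], this would put [c] closer to [t] than it is. *)
pose D := (k1 * s2 + s1) - (k2 * s1 + s2).
have D0 : D != 0.
  have -> : D = (1 - k1) * ((1 - k2) * c - s2) by rewrite /D s1E; ring.
  rewrite mulf_neq0 //; first by rewrite subr_eq0 gt_eqF.
  apply/eqP => hh.
  have E : c - t = (m (g2 z0) - t) + k2 * (c - m z0).
    by rewrite m2E; move: hh; lra.
  have : `|c - t| < `|c - t|.
    rewrite {1}E; apply: (le_lt_trans (ler_normD _ _)).
    rewrite normrM (gtr0_norm k2p).
    have k2b : k2 < `|c - t| / K / h z0 by rewrite ltr_pdivlMr // -h2E.
    have -> : `|c - t| = `|c - t| / K + `|c - t| / K / h z0 * (`|c| + `|m z0|).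
      rewrite -[LHS](@mulfVK _ K) ?gt_eqF //; move: (`|c - t| / K) => N.
      by rewrite /K; field; rewrite gt_eqF.
    apply: ltr_leD => //.
    by apply: ler_pM; [exact: ltW|exact: normr_ge0|exact: ltW|exact: ler_normB].
  by rewrite ltxx.
have [f [Gf gf fg]] := Gi _ (Gc _ _ G2 G1).
have [g3 [G3 _ h3]] : exists g, [/\ G g, `|m (g z0) - t1| < h z0 * (e / `|D|)
    & h (g z0) < h z0 * (e / `|D|)].
  apply: (near _ t1 _ (or_introl erefl)).
  by rewrite mulr_gt0 // divr_gt0 // normr_gt0.
have [k3 [s3 [k3p m3E h3E]]] := Ga _ G3.
have [f3 [Gf3 gf3 fg3]] := Gi _ G3.
(* [f] inverts [g2 \o g1], so [g1 \o g2 \o f] is the translation by [D]; conjugation by [g3] shrinks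
   it to [k3 * D], of size below [e]. *)
pose T := g3 \o (g1 \o g2 \o f) \o f3.
have GT : G T := Gc _ _ (Gc _ _ G3 (Gc _ _ (Gc _ _ G1 G2) Gf)) Gf3.
have TE z : m (T z) = m z + k3 * D /\ h (T z) = h z.
  rewrite /T /= m3E h3E !m1E !h1E m2E h2E.
  have e1 := m2E (g1 (f (f3 z))); have e2 := h2E (g1 (f (f3 z))).
  have e3 := m3E (f3 z); have e4 := h3E (f3 z).
  have := fg (f3 z) => /= fgz; rewrite !fgz m1E h1E fg3 in e1 e2 e3 e4.
  rewrite e3 e4 e1 e2 /D; split; ring.
have [mT hT] := TE z0.
have := disc T GT; rewrite mT hT addrAC subrr add0r normrM (gtr0_norm k3p) => disc'.
have : k3 * `|D| < e.
  rewrite -ltr_pdivlMr ?normr_gt0 //.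
  by move: h3; rewrite h3E mulrC ltr_pM2l.
move=> /disc' /(_ erefl) /eqP; rewrite -subr_eq0 addrAC subrr add0r mulf_eq0 (negbTE D0) orbF.
by rewrite gt_eqF.
Qed.

(** With the common endpoint [(0, 1)] at infinity, [fixp] makes the group act by real affine maps,
    and orbits accumulate at the finite endpoints [t1] and [t2]. *)
Lemma no_common_endpoint (R : realType) (H : Type) (S : H -> R * R * R) Lf G t1 t2 :
  noncrossing_system S Lf G ->
  (forall m1 m2, det2 m1 m2 = 1 -> (forall p q, Lf p q -> Lf (lmap m1 m2 p) (lmap m1 m2 q)) ->
     m2.1 = 0) ->
  t1 != t2 -> Lf (1, t1) (0, 1) -> Lf (1, t2) (0, 1) -> False.
Proof.
move=> ns fixp t12 l1 l2.
have [z0 _] := ns_point ns l1.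
have C0 z := ns_pos2 ns z.
have [e e0 he] := ns_discrete ns z0.
(* The form [S z] is the point [m z + i h z] of the upper half plane. *)
pose m z := - (S z).1.2 / (S z).2; pose h z := ((S z).2)^-1.
have hp z : 0 < h z by rewrite invr_gt0.
have near t d : Lf (1, t) (0, 1) -> 0 < d -> exists g, [/\ G g, `|m (g z0) - t| < d & h (g z0) < d].
  move=> lt d0; have d2 : 0 < (d / 2) ^+ 2 by rewrite exprn_gt0 // divr_gt0.
  have [g [Gg hg _]] := ns_limit ns z0 z0 lt d2.
  exists g; move: hg (C0 (g z0)) (ns_det ns (g z0)); rewrite /m /h.
  case: (S (g z0)) => [[a b] c] /=; rewrite /bil /= => hb c0 dt.
  have key : (- b / c - t) ^+ 2 + (c^-1) ^+ 2 <= (d / 2) ^+ 2.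
    rewrite -(ler_pM2l c0).
    have -> : c * ((- b / c - t) ^+ 2 + (c^-1) ^+ 2) = a + 2 * b * t + c * t ^+ 2.
      have -> : a = (1 + b ^+ 2) / c by rewrite -dt subrK mulfK // gt_eqF.
      by field; rewrite gt_eqF.
    by move: hb; rewrite expr2; lra.
  have sq x : x ^+ 2 <= (d / 2) ^+ 2 -> `|x| < d.
    move=> hx; have d2p : 0 <= d / 2 by rewrite divr_ge0 // ltW.
    have : `|x| <= d / 2 by rewrite -ler_sqr ?nnegrE // real_normK ?num_real.
    by move: d0; lra.
  have := sqr_ge0 (- b / c - t); have := sqr_ge0 c^-1 => s1 s2.
  split => //; first by apply: sq; move: key s1; lra.
  by apply: (le_lt_trans (ler_norm _)); apply: sq; move: key s2; lra.
(* At equal heights [pol] is [2 + (b - b0) ^ 2] for the middle coefficients [b], [b0]. The tolerance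
   gives [|b - b0| < min 1 e], so the square is below [e]. *)
apply: (@affine_group_not_discrete R H m h G z0 t1 t2 (Num.min 1 e * h z0)) => //.
- exact: ns_comp ns.
- exact: ns_inv ns.
- move=> g /(ns_act ns)[m1 [m2 [dm hm Lm]]].
  have m21 := fixp m1 m2 dm Lm.
  case: m1 m2 dm hm m21 {Lm} => [u b] [x v] /=; rewrite /det2 /= => dm hm x0.
  rewrite x0 mulr0 subr0 in dm hm.
  have v0 : v != 0 by apply/eqP => v0; move: dm; rewrite v0 mulr0 => /eqP; rewrite eq_sym oner_eq0.
  have uE : u = v^-1 by rewrite -[LHS](mulfK v0) dm div1r.
  exists (v^-1 ^+ 2), (- b / v); split.
  + by rewrite exprn_even_gt0 //= invr_eq0.
  + move=> z; have := hm z (0, 1) (0, 1); have := hm z (1, 0) (0, 1).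
    rewrite /bil /lmap /= /m => e1 e2.
    have -> : (S (g z)).2 = v ^+ 2 * (S z).2 by move: e2; rewrite expr2; lra.
    have -> : (S (g z)).1.2 = u * v * (S z).1.2 + v * b * (S z).2 by move: e1; lra.
    by rewrite dm; field; rewrite ?v0 ?(gt_eqF (C0 z)).
  + move=> z; have := hm z (0, 1) (0, 1); rewrite /bil /lmap /= /h => e2.
    have -> : (S (g z)).2 = v ^+ 2 * (S z).2 by move: e2; rewrite expr2; lra.
    by rewrite invfM exprVn.
- by move=> d t d0 [] ->; apply: near.
- by rewrite mulr_gt0 // lt_min ltr01.
- move=> g Gg hm hh.
  suff -> : g z0 = z0 by [].
  apply: he => //; move: hm hh (C0 z0) (C0 (g z0)) (ns_det ns z0) (ns_det ns (g z0)).
  rewrite /m /h /pol; case: (S (g z0)) => [[a b] c]; case: (S z0) => [[a0 b0] c0] /=.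
  move=> hm /invr_inj cc c0p cp d1 d2; rewrite cc in hm d2 cp *.
  have aE : a = (1 + b ^+ 2) / c0 by rewrite -d2 subrK mulfK // gt_eqF.
  have a0E : a0 = (1 + b0 ^+ 2) / c0 by rewrite -d1 subrK mulfK // gt_eqF.
  have -> : a * c0 + c0 * a0 - 2 * b * b0 = 2 + (b - b0) ^+ 2.
    by rewrite aE a0E; field; rewrite gt_eqF.
  rewrite ltrD2l.
  have : `|b - b0| < Num.min 1 e.
    move: hm; have -> : - b / c0 - - b0 / c0 = (b0 - b) / c0 by ring.
    by rewrite normrM (gtr0_norm (_ : 0 < c0^-1)) ?invr_gt0 // ltr_pM2r ?invr_gt0 // distrC.
  rewrite lt_min => /andP[l1' l2'].
  rewrite -real_normK ?num_real // expr2; apply: le_lt_trans l2'.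
  by rewrite ler_piMl // ltW.
Qed.

(** * Sweeps of leaves *)

(** Composed with the clamping [c] of the line onto [[a, b]], [f] is Lipschitz on the whole line,
    and the intermediate value theorem applies. *)
Lemma ivt_lipschitz (R : realType) (f : R -> R) (a b w L : R) : a <= b -> 0 < L ->
  (forall u v, a <= u -> u <= v -> v <= b -> f u <= f v <= f u + L * (v - u)) ->
  f a <= w <= f b -> exists u, [/\ a <= u, u <= b & f u = w].
Proof.
move=> ab L0 hf hw.
pose c u := Num.max a (Num.min b u).
have ca u : a <= c u by rewrite le_max lexx.
have cb u : c u <= b by rewrite ge_max ab ge_min lexx.
have cE u : a <= u -> u <= b -> c u = u by move=> au ub; rewrite /c min_r // max_r.
have clip u v : u <= v -> c u <= c v <= c u + (v - u).
  by move=> uv; rewrite /c /Num.max /Num.min; do !case: ifPn; rewrite -?leNgt; lra.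
have Flip u v : u <= v -> `|f (c u) - f (c v)| <= L * (v - u).
  move=> uv; have /andP[c1 c2] := clip _ _ uv.
  have /andP[h1 h2] := hf _ _ (ca u) c1 (cb v).
  by rewrite distrC ger0_norm ?subr_ge0 //; nra.
have Fc : continuous (f \o c).
  move=> x; apply/cvgrPdist_lt => e e0; near=> t.
  have xt : `|x - t| < e / L by near: t; apply: cvgr_dist_lt => //; rewrite divr_gt0.
  have [xlt|tlx] := leP x t.
    apply: (le_lt_trans (Flip _ _ xlt)); rewrite mulrC -ltr_pdivlMr //.
    by apply: le_lt_trans xt; rewrite distrC ler_norm.
  rewrite distrC; apply: (le_lt_trans (Flip _ _ (ltW tlx))).
  by rewrite mulrC -ltr_pdivlMr //; apply: le_lt_trans xt; rewrite ler_norm.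
have Fa : (f \o c) a = f a by rewrite /= cE.
have Fb : (f \o c) b = f b by rewrite /= cE.
have [|u uab fu] := @IVT R (f \o c) a b w ab (continuous_subspaceT Fc).
  by rewrite Fa Fb ge_min le_max; case/andP: hw => -> ->; rewrite orbT.
by exists (c u).
Unshelve. all: by end_near. Qed.

(* The leaf with index [u] passes through the point [i u] of the upper half plane. *)
Definition leaf_sweep (R : realType) (Lf : R * R -> R * R -> Prop) (d : R) (x y : R -> R) : Prop :=
  1 < d /\ forall u, 1 <= u -> u <= d ->
    [/\ 0 < x u, 0 < y u, x u * y u = u ^+ 2 & Lf (1, x u) (1, - y u)].

(** Noncrossing means [(x v - x u) * (y v - y u) >= 0], so [x] and [y] move in the same direction;
    as their product [u ^ 2] grows, this direction is upwards. *)
Lemma sweep_monotone (R : realType) (H : Type) (S : H -> R * R * R) Lf G d x y :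
  noncrossing_system S Lf G -> leaf_sweep Lf d x y ->
  forall u v, 1 <= u -> u <= v -> v <= d -> x u <= x v /\ y u <= y v.
Proof.
move=> ns [d1 hxy] u v u1 uv vd.
have [xu yu xyu lu] := hxy u u1 (le_trans uv vd).
have [xv yv xyv lv] := hxy v (le_trans u1 uv) vd.
have := ns_cross ns lu lv; rewrite /det2 /= => c.
have c' : 0 <= (x v - x u) * (y v - y u).
  rewrite -(pmulr_rge0 _ (mulr_gt0 (addr_gt0 xu yv) (addr_gt0 xv yu))).
  by move: c; lra.
have : x u * y u <= x v * y v by rewrite xyu xyv ler_sqr ?nnegrE //; lra.
move=> p; split; rewrite leNgt; apply/negP => h.
  have yvu : y v <= y u.
    by rewrite leNgt; apply/negP => h2; have : 0 < (x u - x v) * (y v - y u); [rewrite mulr_gt0 // subr_gt0|lra].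
  have : x v * (y u - y v) >= 0 by rewrite mulr_ge0 ?subr_ge0 // ltW.
  have : 0 < (x u - x v) * y u by rewrite mulr_gt0 // subr_gt0.
  by lra.
have yvu : x v <= x u.
  by rewrite leNgt; apply/negP => h2; have : 0 < (x v - x u) * (y u - y v); [rewrite mulr_gt0 // subr_gt0|lra].
have : y v * (x u - x v) >= 0 by rewrite mulr_ge0 ?subr_ge0 // ltW.
have : 0 < (y u - y v) * x u by rewrite mulr_gt0 // subr_gt0.
by lra.
Qed.

(** Since [y] increases too, the growth of [x] is bounded by that of the product [u ^ 2]; so [x] is
    Lipschitz. *)
Lemma sweep_onto (R : realType) (H : Type) (S : H -> R * R * R) Lf G d x y :
  noncrossing_system S Lf G -> leaf_sweep Lf d x y ->
  forall w, x 1 <= w <= x d -> exists u, [/\ 1 <= u, u <= d & x u = w].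
Proof.
move=> ns hs w hw; have mon := sweep_monotone ns hs; have [d1 hxy] := hs.
have [xd _ _ _] := hxy d (ltW d1) (lexx _).
apply: (@ivt_lipschitz _ x _ _ _ (x d * (2 * d)) (ltW d1)) hw; first by nra.
move=> u v u1 uv vd; have [xuv yuv] := mon _ _ u1 uv vd.
have [xvd _] := mon _ _ (le_trans u1 uv) vd (lexx _).
have [xu yu xyu lu] := hxy u u1 (le_trans uv vd).
have [xv yv xyv lv] := hxy v (le_trans u1 uv) vd.
rewrite xuv /=.
have h : (x v - x u) * y u <= v ^+ 2 - u ^+ 2.
  by rewrite -xyu -xyv; nra.
have yE : y u = u ^+ 2 / x u by rewrite -xyu mulrC mulKf // gt_eqF.
have h2 : (x v - x u) * u ^+ 2 <= x u * (v ^+ 2 - u ^+ 2).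
  by rewrite -xyu; nra.
have h3 : x v - x u <= (x v - x u) * u ^+ 2.
  by rewrite ler_peMr ?subr_ge0 // expr2; nra.
have h4 : x u * (v ^+ 2 - u ^+ 2) <= x d * (2 * d) * (v - u).
  have -> : x d * (2 * d) * (v - u) = x d * ((2 * d) * (v - u)) by ring.
  have xud : x u <= x d by lra.
  apply: ler_pM => //; [lra|nra|nra].
lra.
Qed.

(* A point [m + h i] of the upper half plane lying on the geodesic from [p] to
   [q] is horizontally within [h] of one of the endpoints. *)
Lemma endpoint_near_point (R : realType) (X : R * R * R) (p q : R * R) :
  0 < X.2 -> X.1.1 * X.2 - X.1.2 ^+ 2 = 1 -> det2 p q != 0 -> bil X p q = 0 ->
  (p.1 != 0 /\ `|p.2 / p.1 - - X.1.2 / X.2| <= X.2^-1) \/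
  (q.1 != 0 /\ `|q.2 / q.1 - - X.1.2 / X.2| <= X.2^-1).
Proof.
case: X p q => [[a b] c] [p1 p2] [q1 q2] /=; rewrite /det2 /bil /= => c0 dt dpq h.
have cn : c != 0 by rewrite gt_eqF.
(* For finite endpoints: their signed distances from [- b / c] have product [- (1 / c) ^ 2], so they
   cannot both exceed [1 / c] in absolute value. *)
have hE : (c * p2 + b * p1) * (c * q2 + b * q1) + p1 * q1 = 0.
  have -> : (c * p2 + b * p1) * (c * q2 + b * q1) + p1 * q1 =
    c * (a * p1 * q1 + b * (p1 * q2 + p2 * q1) + c * p2 * q2) -
    p1 * q1 * (a * c - b ^+ 2 - 1) by ring.
  by rewrite h dt subrr !mulr0 subr0.
have one r1 r2 : r1 != 0 -> `|r2 / r1 - - b / c| <= c^-1 \/ `|c * r2 + b * r1| > `|r1|.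
  move=> r0; have [|hh] := leP `|c * r2 + b * r1| `|r1|; last by right.
  move=> hh; left.
  have -> : r2 / r1 - - b / c = (c * r2 + b * r1) / (r1 * c) by field; rewrite ?r0 ?cn.
  rewrite normrM normfV normrM (gtr0_norm c0) invfM mulrA.
  by rewrite ler_piMl ?invr_ge0 ?(ltW c0) // ler_pdivrMr ?normr_gt0 // mul1r.
have [p0|p0] := eqVneq p1 0.
  have q0 : q1 != 0 by apply: contra_neq dpq => ->; rewrite p0; ring.
  right; split=> //; have [//|] := one q1 q2 q0.
  have /eqP := hE; rewrite p0 mulr0 mul0r !addr0 mulf_eq0 mulf_eq0 (negbTE cn) /=.
  case/orP=> /eqP e; first by move: dpq; rewrite p0 e !mul0r subr0 eqxx.
  by rewrite e normr0 ltNge normr_ge0.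
have [q0|q0] := eqVneq q1 0.
  left; split=> //; have [//|] := one p1 p2 p0.
  have /eqP := hE; rewrite q0 !mulr0 !addr0 mulf_eq0 (mulf_eq0 c) (negbTE cn) /=.
  case/orP=> /eqP e; last by move: dpq; rewrite q0 e !mulr0 subr0 eqxx.
  by rewrite e normr0 ltNge normr_ge0.
have [|hp] := one p1 p2 p0; first by left.
have [|hq] := one q1 q2 q0; first by right.
have := ltr_pM (normr_ge0 _) (normr_ge0 _) hp hq.
rewrite -!normrM; move/eqP: hE; rewrite addrC addr_eq0 => /eqP ->.
by rewrite normrN ltxx.
Qed.

(** The outermost leaf of the sweep encloses [x'], the innermost does not; a leaf from [x'] crossing
    neither ends in [[- y d, - y 1]] or in [[x 1, x d]]. In the second case it would cross the leaf
    of the sweep that starts halfway between its endpoints. *)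
Lemma leaf_near_sweep (R : realType) (H : Type) (S : H -> R * R * R) Lf G d x y x' q :
  noncrossing_system S Lf G -> leaf_sweep Lf d x y -> x 1 < x' < x d ->
  Lf (1, x') q -> exists y', [/\ y 1 <= y' <= y d, q.1 != 0 & q.2 = q.1 * - y'].
Proof.
move=> ns hs /andP[x1 xd] l; have [d1 hxy] := hs.
have [x1p y1p _ l1] := hxy 1 (lexx _) (ltW d1).
have [xdp ydp _ ld] := hxy d (ltW d1) (lexx _).
have q0 : q.1 != 0.
  apply/eqP => q0; have := ns_neq ns l; have := ns_cross ns l ld.
  case: q q0 {l} => q1 q2 /= ->; rewrite /det2 /= => cr dn.
  have q2p : 0 < q2 ^+ 2.
    by rewrite exprn_even_gt0 //=; apply: contra_neq dn => ->; rewrite !(mulr0, mul0r) subrr.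
  have : 0 < (x d - x') * (y d + x') * q2 ^+ 2 by rewrite mulr_gt0 // mulr_gt0 //; lra.
  by move: cr; rewrite expr2; lra.
have [t qE] : exists t, q.2 = q.1 * t by exists (q.2 / q.1); rewrite mulrC mulfVK.
have tx : t != x'.
  have := ns_neq ns l; rewrite /det2 /= qE; apply: contra_neq => ->; ring.
have cross u : 1 <= u -> u <= d -> 0 <= (x u - x') * ((y u + t) * (x u - t)).
  move=> u1 ud; have [xu yu _ lu] := hxy u u1 ud.
  have q2 : 0 < q.1 ^+ 2 by rewrite exprn_even_gt0.
  have xyp : 0 < y u + x' by lra.
  rewrite -(pmulr_rge0 _ (mulr_gt0 q2 xyp)).
  have := ns_cross ns l lu; rewrite /det2 /= qE.
  by congr (0 <= _); rewrite expr2; ring.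
have cd := cross d (ltW d1) (lexx _); rewrite pmulr_rge0 ?subr_gt0 // in cd.
have c1 := cross 1 (lexx _) (ltW d1); rewrite nmulr_rge0 ?subr_lt0 // in c1.
have t1 : - y d <= t.
  rewrite leNgt; apply/negP => h.
  have : 0 < (- (y d + t)) * (x d - t) by rewrite mulr_gt0 //; lra.
  by lra.
have t2 : t <= x d.
  rewrite leNgt; apply/negP => h.
  have : 0 < ((y d + t)) * (t - x d) by rewrite mulr_gt0 //; lra.
  by lra.
exists (- t); split => //; last by rewrite opprK.
rewrite lerNl lerNr t1 andbT leNgt; apply/negP => h.
have t3 : x 1 <= t.
  rewrite leNgt; apply/negP => h2.
  have : 0 < ((y 1 + t)) * (x 1 - t) by rewrite mulr_gt0 //; lra.
  by lra.
have [|u [u1 ud xu]] := sweep_onto ns hs (w := (x' + t) / 2); first by lra.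
have [xup yup _ _] := hxy u u1 ud.
have := cross u u1 ud; rewrite xu.
have -> : ((x' + t) / 2 - x') * ((y u + t) * ((x' + t) / 2 - t)) =
   - ((t - x') ^+ 2 * ((y u + t) / 4)) by field.
have : 0 < (t - x') ^+ 2 * ((y u + t) / 4).
  by rewrite mulr_gt0 ?exprn_even_gt0 //= ?subr_eq0 //; lra.
by lra.
Qed.

(** A form that is small at [xi] compared with its value at [- y0] is a point near [xi], so a leaf
    through it has an endpoint near [xi], inside the sweep, which confines the other endpoint. *)
Lemma leaf_near_endpoint (R : realType) (H : Type) (S : H -> R * R * R) Lf G d x y xi y0 e :
  noncrossing_system S Lf G -> leaf_sweep Lf d x y -> x 1 < xi < x d -> 0 < y0 -> 0 < e ->
  exists2 r, 0 < r & forall z p q, Lf p q -> bil (S z) p q = 0 ->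
    bil (S z) (1, xi) (1, xi) <= r * bil (S z) (1, - y0) (1, - y0) ->
    exists k l x' y', [/\ k * l != 0, `|x' - xi| <= e, x 1 <= x', y 1 <= y' <= y d &
      (p = (k, k * x') /\ q = (l, l * - y')) \/ (q = (k, k * x') /\ p = (l, l * - y'))].
Proof.
move=> ns hs /andP[x1 xd] y0p e0; have [d1 hxy] := hs.
have [x1p y1p _ _] := hxy 1 (lexx _) (ltW d1).
pose e' := Num.min e (Num.min ((xi - x 1) / 2) ((x d - xi) / 2)).
have e'0 : 0 < e' by rewrite !lt_min e0 /=; apply/andP; split; lra.
have [e'e [e'1 e'2]] : e' <= e /\ e' <= (xi - x 1) / 2 /\ e' <= (x d - xi) / 2.
  by rewrite /e' !ge_min !lexx !orbT.
pose D := xi + y0; have Dp : 0 < D by rewrite /D; lra.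
(* If [s] is the squared distance of the point from [xi], that from [- y0] is at most
   [2 * D ^ 2 + 2 * s]; for this [r], [s <= r * (2 * D ^ 2 + 2 * s)] forces [s <= (e' / 2) ^ 2]. *)
pose r := Num.min (1 / 4) ((e' / 2) ^+ 2 / (4 * D ^+ 2)).
have r0 : 0 < r.
  by rewrite lt_min !divr_gt0 // ?mulr_gt0 ?exprn_gt0 ?divr_gt0.
exists r => // z p q l hpq.
have := ns_pos2 ns z; have := ns_det ns z; have := ns_neq ns l; move: hpq.
move: (S z) => X hpq dpq dX cX hr.
pose m := - X.1.2 / X.2; pose h := X.2^-1.
have near : (xi - m) ^+ 2 + h ^+ 2 <= (e' / 2) ^+ 2.
  have bE t : bil X (1, t) (1, t) = X.2 * ((t - m) ^+ 2 + h ^+ 2).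
    rewrite /bil /= /m /h.
    have -> : X.1.1 = (1 + X.1.2 ^+ 2) / X.2 by rewrite -dX subrK mulfK // gt_eqF.
    by field; rewrite gt_eqF.
  move: hr; rewrite !bE mulrCA ler_pM2l // => hr.
  have s1 : 0 <= (xi - m) ^+ 2 by exact: sqr_ge0.
  have s2 : 0 <= h ^+ 2 by exact: sqr_ge0.
  have b1 : (- y0 - m) ^+ 2 + h ^+ 2 <= 2 * D ^+ 2 + 2 * ((xi - m) ^+ 2 + h ^+ 2).
    have : 0 <= (D + (xi - m)) ^+ 2 by exact: sqr_ge0.
    have -> : - y0 - m = (xi - m) - D by rewrite /D; ring.
    by move: s2; rewrite !expr2; lra.
  have r1 : r <= 1 / 4 by rewrite ge_min lexx.
  have r2 : r * (4 * D ^+ 2) <= (e' / 2) ^+ 2.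
    rewrite -ler_pdivlMr; last by rewrite mulr_gt0 // exprn_gt0.
    by rewrite ge_min lexx orbT.
  have : r * ((- y0 - m) ^+ 2 + h ^+ 2) <= r * (2 * D ^+ 2 + 2 * ((xi - m) ^+ 2 + h ^+ 2)).
    by rewrite ler_pM2l.
  have : r * ((xi - m) ^+ 2 + h ^+ 2) <= 1 / 4 * ((xi - m) ^+ 2 + h ^+ 2).
    by rewrite ler_wpM2r // addr_ge0.
  by lra.
have sq t : t ^+ 2 <= (e' / 2) ^+ 2 -> `|t| <= e' / 2.
  have ep : 0 <= e' / 2 by rewrite divr_ge0 // ltW.
  by move=> ht; rewrite -ler_sqr ?nnegrE // real_normK ?num_real.
have n1 : `|xi - m| <= e' / 2 by apply: sq; have := sqr_ge0 h; lra.
have n2 : h <= e' / 2.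
  by apply: (le_trans (ler_norm _)); apply: sq; have := sqr_ge0 (xi - m); lra.
have one p' q' : Lf p' q' -> p'.1 != 0 -> `|p'.2 / p'.1 - m| <= h ->
    exists k l x' y', [/\ k * l != 0, `|x' - xi| <= e, x 1 <= x', y 1 <= y' <= y d &
      p' = (k, k * x') /\ q' = (l, l * - y')].
  move=> l' p0 hp; pose x' := p'.2 / p'.1.
  have xx : `|x' - xi| <= e'.
    have -> : x' - xi = (x' - m) - (xi - m) by ring.
    by apply: (le_trans (ler_normB _ _)); move: hp n2 n1; rewrite -/x'; lra.
  have := xx; rewrite ler_norml => /andP[xx1 xx2].
  have l2 : Lf (1, x') q'.
    have := ns_scale ns (_ : p'.1^-1 != 0) l'; rewrite invr_eq0 => /(_ p0).
    by rewrite mulVf // mulrC.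
  have [|y' [hy q0 qE]] := leaf_near_sweep ns hs _ l2; first by lra.
  exists p'.1, q'.1, x', y'; split => //; first by rewrite mulf_neq0.
  - exact: le_trans xx e'e.
  - by lra.
  - by rewrite -qE /x' mulrC mulfVK // -!surjective_pairing.
have [[p0 hp]|[q0 hq]] := endpoint_near_point cX dX dpq hpq.
  have [k [l' [x' [y' [h1 h2 h3 h4 h5]]]]] := one p q l p0 hp.
  by exists k, l', x', y'; split => //; left.
have [k [l' [x' [y' [h1 h2 h3 h4 h5]]]]] := one q p (ns_sym ns l) q0 hq.
by exists k, l', x', y'; split => //; right.
Qed.

(* Moving points of both leaves close to the same interior endpoint of the
   sweep makes the cross ratio of their endpoints tend to [0], [1] or [oo]. *)
Lemma leaves_share_endpoint (R : realType) (H : Type) (S : H -> R * R * R) Lf G d x y :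
  noncrossing_system S Lf G -> leaf_sweep Lf d x y -> x 1 < x d ->
  forall p q p' q', Lf p q -> Lf p' q' ->
  det2 p p' * det2 q q' = 0 \/ det2 p q' * det2 q p' = 0.
Proof.
move=> ns hs xlt p q p' q' l l'; have [d1 hxy] := hs.
have [x1p y1p _ _] := hxy 1 (lexx _) (ltW d1).
have [xdp ydp _ _] := hxy d (ltW d1) (lexx _).
apply: contrapT => /not_orP[/eqP n1 /eqP n2].
pose xi := (x 1 + x d) / 2.
have hxi : x 1 < xi < x d by rewrite /xi; lra.
have [|u [u1 ud xu]] := sweep_onto ns hs (w := xi); first by lra.
have [_ y0p _ lu] := hxy u u1 ud; rewrite xu in lu.
pose W := `|det2 p q * det2 p' q'|.
have W0 : 0 < W by rewrite normr_gt0 mulf_neq0 ?(ns_neq ns).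
pose M := Num.min `|det2 p p' * det2 q q'| `|det2 p q' * det2 q p'|.
have M0 : 0 < M by rewrite lt_min !normr_gt0 n1.
(* Chosen so that the final estimates give [M <= M / 2]. *)
pose e := M * x 1 ^+ 2 / (4 * y d * W).
have e0 : 0 < e by rewrite divr_gt0 ?mulr_gt0 ?exprn_gt0.
have [r r0 hr] := leaf_near_endpoint ns hs hxi y0p e0.
have [z1 hz1] := ns_point ns l; have [z2 hz2] := ns_point ns l'.
have [g [Gg g1 g2]] := ns_limit ns z1 z2 lu r0.
(* The matrix in [ns_act] belongs to the pullback of forms, so that of the inverse [f] carries the
   leaves to those through [g z1] and [g z2]. *)
have [f [Gf gf _]] := ns_inv ns Gg.
have [m1 [m2 [dm hm Lm]]] := ns_act ns Gf.
have [] := hr (g z1) _ _ (Lm _ _ l) _ g1; first by rewrite -hm gf.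
move=> k1 [l1 [a [b [kl1 ha a1 hb E1]]]].
have [] := hr (g z2) _ _ (Lm _ _ l') _ g2; first by rewrite -hm gf.
move=> k2 [l2 [a' [b' [kl2 ha' a1' hb' E2]]]].
have dE v w : det2 v w = det2 (lmap m1 m2 v) (lmap m1 m2 w) by rewrite det2_lmap dm mul1r.
pose K := `|k1 * l1 * (k2 * l2)|.
have K0 : 0 < K by rewrite normr_gt0 mulf_neq0.
(* The endpoints are [a], [a'] near [xi] and the opposite ones [- b], [- b']: the denominator of the
   cross ratio is bounded below, while one numerator has the small factor [a - a']. *)
have WE : W = K * ((a + b) * (a' + b')).
  have abp : 0 <= (a + b) * (a' + b') by rewrite mulr_ge0 //; lra.
  rewrite -[X in _ * X](ger0_norm abp) /K -normrM /W (dE p) (dE p').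
  case: E1 => [[-> ->]|[-> ->]]; case: E2 => [[-> ->]|[-> ->]]; rewrite /det2 /=;
   [|rewrite -normrN|rewrite -normrN|]; congr `| _ |; ring.
have small : M <= K * (`|a - a'| * `|b - b'|).
  rewrite /K -!normrM /M ge_min (dE p p') (dE q q') (dE p q') (dE q p').
  case: E1 => [[-> ->]|[-> ->]]; case: E2 => [[-> ->]|[-> ->]]; rewrite /det2 /=;
  [apply/orP; left|apply/orP; right|apply/orP; right|apply/orP; left];
  rewrite le_eqVlt; apply/orP; left; apply/eqP; rewrite -normrN; congr `| _ |; ring.
have aa : `|a - a'| <= 2 * e.
  have -> : a - a' = (a - xi) - (a' - xi) by ring.
  by apply: (le_trans (ler_normB _ _)); lra.
have bb : `|b - b'| <= y d by rewrite ler_norml; lra.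
have : K * (`|a - a'| * `|b - b'|) <= K * (2 * e * y d).
  by rewrite ler_pM2l //; apply: ler_pM.
have xx : x 1 ^+ 2 <= (a + b) * (a' + b') by rewrite expr2; apply: ler_pM; lra.
have -> : K * (2 * e * y d) = M / 2 * (x 1 ^+ 2 / ((a + b) * (a' + b'))).
  have abp : 0 < a + b by lra.
  have abp' : 0 < a' + b' by lra.
  by rewrite /e WE; field; rewrite !gt_eqF.
have : x 1 ^+ 2 / ((a + b) * (a' + b')) <= 1.
  by rewrite ler_pdivrMr ?mul1r // mulr_gt0 //; lra.
move=> h; have : M / 2 * (x 1 ^+ 2 / ((a + b) * (a' + b'))) <= M / 2 * 1.
  by rewrite ler_pM2l // divr_gt0.
by lra.
Qed.

(** Leaves of the sweep that differ in [x] can only share the endpoint [- y]. This gives three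
    leaves with the common endpoint [- y 1], which is then an endpoint of every leaf. *)
Lemma no_sweep (R : realType) (H : Type) (S : H -> R * R * R) Lf G d x y :
  noncrossing_system S Lf G -> leaf_sweep Lf d x y -> x 1 < x d -> False.
Proof.
move=> ns hs xlt; have [d1 hxy] := hs.
have share := leaves_share_endpoint ns hs xlt.
have [x1p y1p _ l1] := hxy 1 (lexx _) (ltW d1).
have [xdp ydp _ ld] := hxy d (ltW d1) (lexx _).
pose xi := (x 1 + x d) / 2.
have [|u [u1 ud xu]] := sweep_onto ns hs (w := xi); first by rewrite /xi; lra.
have [xup yup _ lu] := hxy u u1 ud.
have yE v w : 1 <= v -> v <= d -> 1 <= w -> w <= d -> x v != x w -> y v = y w.
  move=> v1 vd w1 wd vw.
  have [xv yv _ lv] := hxy v v1 vd; have [xw yw _ lw] := hxy w w1 wd.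
  have xy1 : 0 < (y w + x v) * (x w + y v) by rewrite mulr_gt0 // addr_gt0.
  have [] := share _ _ _ _ lv lw; rewrite /det2 /= => hh; last by move: hh xy1; lra.
  have /eqP : (x w - x v) * (y v - y w) = 0 by move: hh; lra.
  by rewrite mulf_eq0 !subr_eq0 eq_sym (negbTE vw) => /eqP.
have yu : y u = y 1.
  by apply: yE; rewrite // ?ltW // xu /xi gt_eqF //; lra.
have yd : y d = y 1 by apply: yE; rewrite // ?gt_eqF // ltW.
rewrite yu in lu; rewrite yd in ld.
(* A leaf missing [- y 1] would need three distinct endpoints, one for each of the leaves starting
   at [x 1], [x u], [x d]. *)
have common p q : Lf p q -> det2 p (1, - y 1) = 0 \/ det2 q (1, - y 1) = 0.
  move=> l; apply: contrapT => /not_orP[/eqP n1 /eqP n2].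
  have a1 : (det2 p (1, x 1) == 0) || (det2 q (1, x 1) == 0).
    have [] := share _ _ _ _ l l1 => /eqP; rewrite mulf_eq0.
      by rewrite (negbTE n2) orbF => ->.
    by rewrite (negbTE n1) /= => ->; rewrite orbT.
  have a2 : (det2 p (1, x u) == 0) || (det2 q (1, x u) == 0).
    have [] := share _ _ _ _ l lu => /eqP; rewrite mulf_eq0.
      by rewrite (negbTE n2) orbF => ->.
    by rewrite (negbTE n1) /= => ->; rewrite orbT.
  have a3 : (det2 p (1, x d) == 0) || (det2 q (1, x d) == 0).
    have [] := share _ _ _ _ l ld => /eqP; rewrite mulf_eq0.
      by rewrite (negbTE n2) orbF => ->.
    by rewrite (negbTE n1) /= => ->; rewrite orbT.
  have two v s t : det2 v (1, - y 1) != 0 -> s != t -> det2 v (1, s) == 0 -> det2 v (1, t) == 0 -> False.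
    case: v => v1 v2; rewrite /det2 /= => n st /eqP e1 /eqP e2.
    have /eqP : v1 * (s - t) = 0 by move: e1 e2; lra.
    rewrite mulf_eq0 subr_eq0 (negbTE st) orbF => /eqP v10.
    by move: n e1; rewrite v10 !mul0r !mulr1 !sub0r => /eqP n /n.
  have x1u : x 1 != x u by rewrite xu lt_eqF // /xi; lra.
  have xud : x u != x d by rewrite xu lt_eqF // /xi; lra.
  have x1d : x 1 != x d by rewrite lt_eqF.
  by case/orP: a1 => b1; case/orP: a2 => b2; case/orP: a3 => b3;
    first [exact: two n1 x1u b1 b2|exact: two n1 x1d b1 b3|exact: two n1 xud b2 b3|
           exact: two n2 x1u b1 b2|exact: two n2 x1d b1 b3|exact: two n2 xud b2 b3].
(* The new basis moves [- y 1] to infinity and [x v] to [(x v + y 1)^-1]. *)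
have dn : det2 (0, 1) (1, - y 1) ^+ 2 = 1 by rewrite /det2 /=; ring.
have ns' := ns_pullback dn ns.
have leafE v : 0 < x v -> Lf (1, x v) (1, - y 1) ->
    Lf (lmap (0, 1) (1, - y 1) (1, (x v + y 1)^-1)) (lmap (0, 1) (1, - y 1) (0, 1)).
  move=> xv lv; have n0 : (x v + y 1)^-1 != 0 by rewrite invr_eq0 gt_eqF // addr_gt0.
  have := ns_scale ns n0 lv; rewrite /lmap /=.
  congr Lf; congr pair; try ring.
  by field; rewrite gt_eqF // addr_gt0.
have tne : (x 1 + y 1)^-1 != (x d + y 1)^-1.
  by rewrite (inj_eq invr_inj) (inj_eq (addIr _)) lt_eqF.
apply: (no_common_endpoint ns' _ tne); [|exact: leafE|exact: leafE].
move=> m1 m2 dm hm; apply/eqP/negP => /negP m20.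
(* A symmetry moving infinity would have to send both finite endpoints to infinity, since every
   image leaf ends there. *)
have fixed v : 0 < x v -> Lf (1, x v) (1, - y 1) -> m1.1 + (x v + y 1)^-1 * m2.1 = 0.
  move=> xv lv; have := hm _ _ (leafE v xv lv); rewrite /lmap /= => /common.
  by rewrite /det2 /=; case=> h; [lra|move: m20; rewrite (_ : m2.1 = 0) ?eqxx //; lra].
have e1 := fixed 1 x1p l1; have ed := fixed d xdp ld.
have /eqP : ((x 1 + y 1)^-1 - (x d + y 1)^-1) * m2.1 = 0 by move: e1 ed; lra.
by rewrite mulf_eq0 (negbTE m20) orbF subr_eq0 (negbTE tne).
Qed.

(** * From an open set of leaves to a sweep *)

Lemma leaf_sweep_exists (R : realType) (H : Type) (S : H -> R * R * R) Lf G d :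
  noncrossing_system S Lf G -> Lf (1, 1) (1, -1) -> 1 < d ->
  (forall u, 1 <= u -> u <= d -> exists p q, Lf p q /\ u * p.1 * q.1 + p.2 * q.2 / u = 0) ->
  exists x y, leaf_sweep Lf d x y.
Proof.
move=> ns l0 d1 hu.
(* The diagonal form [(u, 0, 1 / u)] is the point [i u]. A leaf through it with an endpoint at
   infinity is the imaginary axis, which crosses the leaf from [1] to [-1]. *)
have nz p q : Lf p q -> forall u, u != 0 -> u * p.1 * q.1 + p.2 * q.2 / u = 0 -> p.1 != 0.
  move=> l u u0 h; apply/eqP => p0.
  have := ns_neq ns l; have := ns_cross ns l l0.
  move: h; rewrite p0 mulr0 mul0r add0r => /eqP; rewrite mulf_eq0 invr_eq0 (negbTE u0) orbF.
  case: p q l p0 => [p1 p2] [q1 q2] /= _ ->; rewrite mulf_eq0 /det2 /= !mul0r !sub0r.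
  case/orP => /eqP ->; first by rewrite !(mul0r, oppr0) eqxx.
  move=> cr; rewrite oppr_eq0 mulf_eq0 negb_or => /andP[p0 q0].
  have : 0 < p2 ^+ 2 * q1 ^+ 2 by rewrite mulr_gt0 // exprn_even_gt0.
  by move: cr; rewrite !expr2; lra.
have ex u : exists ab : R * R, 1 <= u -> u <= d ->
    [/\ 0 < ab.1, 0 < ab.2, ab.1 * ab.2 = u ^+ 2 & Lf (1, ab.1) (1, - ab.2)].
  have [u1|] := boolP (1 <= u); last by exists (0, 0).
  have [ud|] := boolP (u <= d); last by exists (0, 0).
  have u0 : 0 < u by lra.
  have un : u != 0 by rewrite gt_eqF.
  have [p [q [l h]]] := hu u u1 ud.
  have p0 := nz p q l u un h.
  have q0 : q.1 != 0.
    apply: (nz q p (ns_sym ns l) u un).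
    by rewrite -[RHS]h; ring.
  have [t pE] : exists t, p.2 = p.1 * t by exists (p.2 / p.1); rewrite mulrC mulfVK.
  have [s qE] : exists s, q.2 = q.1 * s by exists (q.2 / q.1); rewrite mulrC mulfVK.
  have l' : Lf (1, t) (1, s).
    have pi : p.1^-1 != 0 by rewrite invr_eq0.
    have qi : q.1^-1 != 0 by rewrite invr_eq0.
    have := ns_scale ns pi l; rewrite mulVf // pE mulKf // => /(ns_sym ns) l2.
    by have := ns_scale ns qi l2; rewrite mulVf // qE mulKf // => /(ns_sym ns).
  have ts : t * s = - u ^+ 2.
    have : p.1 * q.1 * (u ^+ 2 + t * s) = 0.
      have -> : p.1 * q.1 * (u ^+ 2 + t * s) = u * (u * p.1 * q.1 + p.2 * q.2 / u).
        by rewrite pE qE; field.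
      by rewrite h mulr0.
    move/eqP; rewrite !mulf_eq0 (negbTE p0) (negbTE q0) /= => /eqP; lra.
  have u2 : 0 < u ^+ 2 by rewrite exprn_gt0.
  (* The endpoints have opposite signs; the positive one becomes [x u]. *)
  have [t0|t0] := leP t 0; last first.
    exists (t, - s) => _ _ /=; rewrite opprK; split => //; last by rewrite mulrN ts opprK.
    by rewrite -(pmulr_rgt0 _ t0) mulrN ts opprK.
  have s0 : 0 < s.
    rewrite ltNge; apply/negP => s0; have : 0 <= t * s by rewrite mulr_le0.
    by rewrite ts; lra.
  exists (s, - t) => _ _ /=; rewrite opprK; split => //.
  - by rewrite -(pmulr_rgt0 _ s0) mulrN mulrC ts opprK.
  - by rewrite mulrN mulrC ts opprK.
  - exact: (ns_sym ns l').
have [f hf] := choice ex.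
by exists (fun u => (f u).1), (fun u => (f u).2); split.
Qed.

(** The product [x u * y u] grows, so if [x] stays constant then [y] does not, and reflection in the
    imaginary axis exchanges the two. *)
Lemma leaf_sweep_nonexistent (R : realType) (H : Type) (S : H -> R * R * R) Lf G d x y :
  noncrossing_system S Lf G -> leaf_sweep Lf d x y -> False.
Proof.
move=> ns hs; have [d1 hxy] := hs.
have [x1 y1 xy1 _] := hxy 1 (lexx _) (ltW d1).
have [xd yd xyd _] := hxy d (ltW d1) (lexx _).
have [hx|hx] := ltP (x 1) (x d); first exact: (no_sweep ns hs hx).
have [_ hy] := sweep_monotone ns hs (lexx _) (ltW d1) (lexx _).
have hy' : y 1 < y d.
  rewrite ltNge; apply/negP => hy'.
  have : x d * y d <= x 1 * y 1 by apply: ler_pM => //; apply: ltW.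
  by rewrite xy1 xyd expr1n leNgt expr2; nra.
have dn : det2 (1, 0) (0, -1) ^+ 2 = 1 :> R by rewrite /det2 /=; ring.
apply: (no_sweep (ns_pullback dn ns) (d := d) (x := y) (y := x)) => //.
split=> // u u1 ud; have [xu yu xyu lu] := hxy u u1 ud.
split=> //; first by rewrite mulrC.
have -> : lmap (1, 0) (0, -1) (1, y u) = (1, - y u) by rewrite /lmap /=; congr pair; ring.
have -> : lmap (1, 0) (0, -1) (1, - x u) = (1, x u) by rewrite /lmap /=; congr pair; ring.
exact: (ns_sym ns lu).
Qed.

(** A basis adapted to a leaf through [X0] puts [X0] at [i] and the leaf on the unit semicircle; the
    leaves through the points [i u] of the perpendicular form a sweep. *)
Lemma leaves_have_empty_interior (R : realType) (H : Type) (S : H -> R * R * R) Lf G X0 e :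
  noncrossing_system S Lf G -> 0 < e ->
  0 < X0.1.1 -> X0.1.1 * X0.2 - X0.1.2 ^+ 2 = 1 ->
  ~ (forall X, 0 < X.1.1 -> X.1.1 * X.2 - X.1.2 ^+ 2 = 1 -> pol X X0 < 2 + e ->
     exists p q, Lf p q /\ bil X p q = 0).
Proof.
move=> ns e0 a0 dX0 hX.
have [|p [q [l hpq]]] := hX X0 a0 dX0.
  by rewrite /pol; move: dX0; rewrite expr2; lra.
have dpq := ns_neq ns l.
have posX v : v != (0, 0) -> 0 < bil X0 v v by apply: bil_pos; rewrite // dX0.
have pP : 0 < bil X0 p p.
  by apply: posX; apply: contra_neq dpq => ->; rewrite /det2 !mul0r subrr.
have qP : 0 < bil X0 q q.
  by apply: posX; apply: contra_neq dpq => ->; rewrite /det2 !mulr0 subrr.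
(* This scaling makes [f1], [f2] orthonormal for [X0], with [f1 + f2] and [f1 - f2] multiples of [p]
   and [q]. *)
pose kp := Num.sqrt (2 * bil X0 p p)^-1; pose kq := Num.sqrt (2 * bil X0 q q)^-1.
have kp0 : 0 < kp by rewrite sqrtr_gt0 invr_gt0 mulr_gt0.
have kq0 : 0 < kq by rewrite sqrtr_gt0 invr_gt0 mulr_gt0.
have kp2 : 2 * (kp ^+ 2 * bil X0 p p) = 1.
  by rewrite sqr_sqrtr ?invr_ge0 ?mulr_ge0 ?ltW //; field; rewrite gt_eqF.
have kq2 : 2 * (kq ^+ 2 * bil X0 q q) = 1.
  by rewrite sqr_sqrtr ?invr_ge0 ?mulr_ge0 ?ltW //; field; rewrite gt_eqF.
pose f1 := (kp * p.1 + kq * q.1, kp * p.2 + kq * q.2).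
pose f2 := (kp * p.1 - kq * q.1, kp * p.2 - kq * q.2).
have f11 : bil X0 f1 f1 = 1.
  have -> : bil X0 f1 f1 = kp ^+ 2 * bil X0 p p + kq ^+ 2 * bil X0 q q + 2 * kp * kq * bil X0 p q.
    by rewrite /bil /f1 /=; ring.
  by rewrite hpq; lra.
have f22 : bil X0 f2 f2 = 1.
  have -> : bil X0 f2 f2 = kp ^+ 2 * bil X0 p p + kq ^+ 2 * bil X0 q q - 2 * kp * kq * bil X0 p q.
    by rewrite /bil /f2 /=; ring.
  by rewrite hpq; lra.
have f12 : bil X0 f1 f2 = 0.
  have -> : bil X0 f1 f2 = kp ^+ 2 * bil X0 p p - kq ^+ 2 * bil X0 q q.
    by rewrite /bil /f1 /f2 /=; ring.
  by lra.
have gram : bil X0 f1 f1 * bil X0 f2 f2 - bil X0 f1 f2 ^+ 2 =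
    det2 f1 f2 ^+ 2 * (X0.1.1 * X0.2 - X0.1.2 ^+ 2) by rewrite /bil /det2; ring.
have dn : det2 f1 f2 ^+ 2 = 1 by move: gram; rewrite f11 f22 f12 dX0; lra.
have dn0 : det2 f1 f2 != 0 by apply/eqP => h; move: dn; rewrite h expr0n /= => /eqP; rewrite eq_sym oner_eq0.
have ns' := ns_pullback dn ns.
(* Between [i u] and [i], [pol] is [u + 1 / u = 2 + (u - 1) ^ 2 / u], which is below [2 + e] for
   [1 <= u <= d]. *)
pose d := 1 + Num.min e 1 / 2.
have m0 : 0 < Num.min e 1 by rewrite lt_min e0 ltr01.
have d1 : 1 < d by rewrite /d; lra.
have [x [y hs]] : exists x y, leaf_sweep (fun p q => Lf (lmap f1 f2 p) (lmap f1 f2 q)) d x y.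
  apply: (leaf_sweep_exists ns') => //.
    have -> : lmap f1 f2 (1, 1) = ((2 * kp) * p.1, (2 * kp) * p.2).
      by rewrite /lmap /f1 /f2 /=; congr pair; ring.
    have -> : lmap f1 f2 (1, -1) = ((2 * kq) * q.1, (2 * kq) * q.2).
      by rewrite /lmap /f1 /f2 /=; congr pair; ring.
    apply: (ns_scale ns); first by rewrite mulf_neq0 // gt_eqF.
    apply: (ns_sym ns); apply: (ns_scale ns); first by rewrite mulf_neq0 // gt_eqF.
    exact: (ns_sym ns l).
  move=> u u1 ud; have u0 : 0 < u by lra.
  have un : u != 0 by rewrite gt_eqF.
  (* The form that is diagonal with entries [u], [1 / u] in the basis [f1], [f2]. *)
  pose X : R * R * R := (u * f2.2 ^+ 2 + f1.2 ^+ 2 / u,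
            - (u * f2.2 * f2.1 + f1.2 * f1.1 / u),
            u * f2.1 ^+ 2 + f1.1 ^+ 2 / u).
  have XE v w : bil X (lmap f1 f2 v) (lmap f1 f2 w) =
      det2 f1 f2 ^+ 2 * (u * v.1 * w.1 + v.2 * w.2 / u).
    by rewrite /X /bil /lmap /det2 /=; ring.
  have dX : X.1.1 * X.2 - X.1.2 ^+ 2 = 1.
    have -> : X.1.1 * X.2 - X.1.2 ^+ 2 = det2 f1 f2 ^+ 2 by rewrite /X /det2 /=; field.
    by [].
  have X0E : X0 = (f2.2 ^+ 2 + f1.2 ^+ 2, - (f2.2 * f2.1 + f1.2 * f1.1), f2.1 ^+ 2 + f1.1 ^+ 2).
    pose j1 := inv_lmap f1 f2 (1, 0); pose j2 := inv_lmap f1 f2 (0, 1).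
    have J v w : bil X0 (lmap f1 f2 v) (lmap f1 f2 w) = v.1 * w.1 + v.2 * w.2.
      rewrite -bil_pullback /pullback f11 f22 f12 /bil /=; ring.
    have b1 : X0.1.1 = bil X0 (1, 0) (1, 0) by rewrite /bil /=; ring.
    have b2 : X0.1.2 = bil X0 (1, 0) (0, 1) by rewrite /bil /=; ring.
    have b3 : X0.2 = bil X0 (0, 1) (0, 1) by rewrite /bil /=; ring.
    have i1 := inv_lmapK (1, 0) dn0; have i2 := inv_lmapK (0, 1) dn0.
    have sq a b : a / det2 f1 f2 * (b / det2 f1 f2) = a * b.
      by rewrite mulrACA -invfM -expr2 dn invr1 mulr1.
    rewrite [LHS]surjective_pairing (surjective_pairing X0.1) b1 b2 b3 -i1 -i2 !J /inv_lmap /=.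
    by rewrite !sq /det2 /=; do 2?congr pair; ring.
  have [|//||p' [q' [l' h']]] := hX X.
  - rewrite lt_def; apply/andP; split.
      by apply/eqP => X0'; move: dX; rewrite X0' mul0r sub0r => h; have := sqr_ge0 X.1.2; lra.
    by rewrite /X /=; apply: addr_ge0; [apply: mulr_ge0|apply: divr_ge0]; rewrite ?sqr_ge0 ?(ltW u0).
  - have -> : pol X X0 = det2 f1 f2 ^+ 2 * (u + u^-1).
      by rewrite X0E /X /pol /det2 /=; ring.
    rewrite dn mul1r.
    have hu : u + u^-1 = 2 + (u - 1) ^+ 2 / u by field.
    rewrite hu ltrD2l ltr_pdivrMr //.
    have u2 : u - 1 <= Num.min e 1 / 2 by move: ud; rewrite /d; lra.
    have m1 : Num.min e 1 <= 1 by rewrite ge_min lexx orbT.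
    have me : Num.min e 1 <= e by rewrite ge_min lexx.
    rewrite expr2; nra.
  exists (inv_lmap f1 f2 p'), (inv_lmap f1 f2 q').
  rewrite !inv_lmapK //; split=> //.
  by have := XE (inv_lmap f1 f2 p') (inv_lmap f1 f2 q'); rewrite !inv_lmapK // h' dn mul1r.
exact: (leaf_sweep_nonexistent ns' hs).
Qed.

(** * The disk as a space of quadratic forms *)

Definition norm2 (R : realType) (z : R[i]) : R := complex.Re z ^+ 2 + complex.Im z ^+ 2.

Lemma norm2_ge0 (R : realType) (z : R[i]) : 0 <= norm2 z.
Proof. by rewrite addr_ge0 ?sqr_ge0. Qed.

Lemma norm2M (R : realType) (z w : R[i]) : norm2 (z * w) = norm2 z * norm2 w.
Proof. by case: z w => [a b] [c d]; rewrite /norm2 /=; ring. Qed.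

Lemma norm2_eq0 (R : realType) (z : R[i]) : norm2 z = 0 -> z = 0.
Proof.
case: z => a b; rewrite /norm2 /= => /eqP; rewrite paddr_eq0 ?sqr_ge0 // !sqrf_eq0.
by case/andP => /eqP -> /eqP ->.
Qed.

Lemma norm2_sqr (R : realType) (z : R[i]) : (norm2 z)%:C%C = `|z| ^+ 2.
Proof. exact: add_Re2_Im2. Qed.

Lemma cabsE (R : realType) (z : R[i]) : cabs (z : R[i]^o) = Num.sqrt (norm2 z).
Proof. by rewrite /cabs normc_def. Qed.

Lemma norm_lt (R : realType) (z : R[i]) (r : R) : 0 < r -> (`|z| < r%:C%C) = (norm2 z < r ^+ 2).
Proof.
move=> r0; rewrite normc_def ltcR -/(norm2 z).
by rewrite -[in LHS](ger0_norm (ltW r0)) -sqrtr_sqr ltr_sqrt // exprn_gt0.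
Qed.

Lemma hval_norm2 (R : realType) (z : hplane R) : norm2 (hval z) < 1.
Proof.
have := set_valP z; rewrite /= -/(hval z) => h.
by have := norm_lt (hval z) (ltr01); rewrite expr1n h => <-.
Qed.

Lemma hval_inj (R : realType) : injective (@hval R).
Proof. exact: val_inj. Qed.

Lemma hval_surj (R : realType) (w : R[i]) : norm2 w < 1 -> exists z : hplane R, hval z = w.
Proof.
move=> h; have hw : [set z : R[i]^o | `|z| < 1] w.
  by have := norm_lt w (ltr01); rewrite expr1n h.
by exists (exist _ w (mem_set hw)).
Qed.

Lemma nbhs_norm2 (R : realType) (B : set R[i]^o) (z : R[i]^o) :
  nbhs z B <-> exists2 e : R, 0 < e & forall w, norm2 (w - z) < e -> B w.
Proof.
have nE (w v : R[i]) : norm2 (w - v) = norm2 (v - w).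
  by rewrite /norm2; case: w v => [a b] [c d] /=; ring.
split=> [/nbhs_ballP[[r s]]|[e e0 hB]].
  rewrite /= ltcE /= => /andP[/eqP -> r0] hB.
  exists (r ^+ 2); first exact: exprn_gt0.
  by move=> w hw; apply: hB; rewrite -ball_normE /= (norm_lt _ r0) nE.
apply/nbhs_ballP; exists (Num.sqrt e)%:C%C; first by rewrite /= ltcR sqrtr_gt0.
move=> w; rewrite -ball_normE /= norm_lt ?sqrtr_gt0 // sqr_sqrtr ?ltW // nE.
exact: hB.
Qed.

Lemma closure_norm2 (R : realType) (A : set R[i]^o) (z : R[i]^o) :
  closure A z <-> forall e : R, 0 < e -> exists w, A w /\ norm2 (w - z) < e.
Proof.
split=> [cl e e0|h B /nbhs_norm2[e e0 hB]].
  by have [|w [Aw Bw]] := cl [set w | norm2 (w - z) < e]; [apply/nbhs_norm2; exists e|exists w].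
by have [w [Aw hw]] := h _ e0; exists w; split=> //; apply: hB.
Qed.

(* The form [p |-> |c + z c^*|^2 / (1 - |z|^2)], where [c = p.1 + i p.2]. *)
Definition hform (R : realType) (z : hplane R) : R * R * R :=
  let x := complex.Re (hval z) in let y := complex.Im (hval z) in
  let n := 1 - norm2 (hval z) in
  (((1 + x) ^+ 2 + y ^+ 2) / n, 2 * y / n, ((1 - x) ^+ 2 + y ^+ 2) / n).

Lemma hform_pos (R : realType) (z : hplane R) : 0 < (hform z).1.1.
Proof.
have := hval_norm2 z; rewrite /hform /norm2 /=; set x := complex.Re _; set y := complex.Im _ => h.
rewrite divr_gt0 ?subr_gt0 //.
have x1 : 0 < (1 + x) ^+ 2.
  rewrite exprn_even_gt0 //=; apply/eqP => x0.
  have xe : x = -1 by lra.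
  by have := sqr_ge0 y; move: h; rewrite xe sqrrN expr1n; lra.
by rewrite ltr_wpDr // sqr_ge0.
Qed.

Lemma hform_det (R : realType) (z : hplane R) :
  (hform z).1.1 * (hform z).2 - (hform z).1.2 ^+ 2 = 1.
Proof.
have := hval_norm2 z; rewrite /hform /norm2 /=; set x := complex.Re _; set y := complex.Im _ => h.
by field; rewrite subr_eq0 gt_eqF.
Qed.

(** The preimage is the stereographic projection of the hyperboloid onto the disk. *)
Lemma hform_surj (R : realType) (X : R * R * R) :
  0 < X.1.1 -> X.1.1 * X.2 - X.1.2 ^+ 2 = 1 -> exists z, hform z = X.
Proof.
case: X => [[a b] c] /= a0 dt.
have c0 : 0 < c.
  by rewrite -(pmulr_rgt0 _ a0); have := sqr_ge0 b; lra.
have [E EE] : exists E, E = (a + c) / 2 + 1 by eexists.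
have E0 : 0 < E by rewrite EE; lra.
have En : E != 0 by rewrite gt_eqF.
have b2 : b ^+ 2 = a * c - 1 by lra.
have cE : c = 2 * (E - 1) - a by rewrite EE; field.
pose w : R[i] := Complex ((a - c) / 2 / E) (b / E).
have nE : norm2 w = 1 - 2 / E.
  have -> : norm2 w = (((a - c) / 2) ^+ 2 + b ^+ 2) / E ^+ 2.
    by rewrite /norm2 /w /=; field.
  by rewrite b2 cE; field.
have [|z zE] := @hval_surj R w.
  by rewrite nE ltrBlDr ltrDl divr_gt0.
exists z; rewrite /hform zE nE /w /=.
have -> : 1 - (1 - 2 / E) = 2 / E by ring.
congr (_, _, _).
- rewrite !expr_div_n b2 cE; field; exact: En.
- by field; exact: En.
- rewrite !expr_div_n b2 cE; field; exact: En.
Qed.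

(** Twice the classical formula for the hyperbolic cosine of the distance in the disk. *)
Lemma pol_hform (R : realType) (z w : hplane R) : pol (hform z) (hform w) =
  2 + 4 * norm2 (hval z - hval w) / ((1 - norm2 (hval z)) * (1 - norm2 (hval w))).
Proof.
have := hval_norm2 z; have := hval_norm2 w.
rewrite /pol /hform /norm2; case: (hval z) (hval w) => [a b] [c d] /= h1 h2.
by field; rewrite !subr_eq0 !gt_eqF.
Qed.

Lemma nbhs_hplane (R : realType) (z0 : hplane R) (U : set (hplane R)) : nbhs z0 U ->
  exists2 e, 0 < e & forall z, pol (hform z) (hform z0) < 2 + e -> U z.
Proof.
move=> [B [[V oV <-] /= Vz sB]].
have : nbhs (hval z0) V by apply: open_nbhs_nbhs; split.
move=> /nbhs_norm2[r r0 hB].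
exists (4 * r); first by rewrite mulr_gt0.
move=> z; rewrite pol_hform ltrD2l => hz; apply: sB => /=; apply: hB.
rewrite -/(hval z).
have h1 := hval_norm2 z; have h2 := hval_norm2 z0.
have g1 := norm2_ge0 (hval z); have g2 := norm2_ge0 (hval z0).
move: hz; rewrite ltr_pdivrMr; last by rewrite mulr_gt0 // subr_gt0.
have d1 : (1 - norm2 (hval z)) * (1 - norm2 (hval z0)) <= 1 by nra.
have : 4 * r * ((1 - norm2 (hval z)) * (1 - norm2 (hval z0))) <= 4 * r.
  by rewrite ler_piMr // mulr_ge0 // ltW.
by lra.
Qed.

(** * Geodesics and isometries of the disk *)

Lemma hform_inj (R : realType) : injective (@hform R).
Proof.
move=> z w zw; have := pol_hform z w; rewrite zw.
have -> : pol (hform w) (hform w) = 2.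
  by have := hform_det w; rewrite /pol expr2; lra.
have h1 := hval_norm2 z; have h2 := hval_norm2 w.
move=> /eqP; rewrite -subr_eq0 opprD addrA subrr sub0r oppr_eq0 !mulf_eq0 invr_eq0.
rewrite pnatr_eq0 /= mulf_eq0 !subr_eq0 !(gt_eqF h1) !(gt_eqF h2) !orbF => /eqP /norm2_eq0 /eqP.
by rewrite subr_eq0 => /eqP /hval_inj.
Qed.

(** Rests on [|1 - conj z w|^2 - |z - w|^2 = (1 - |z|^2) (1 - |w|^2)]. *)
Lemma expR_hdist (R : realType) (z w : hplane R) :
  0 <= hdist z w /\ expR (hdist z w) + expR (- hdist z w) = pol (hform z) (hform w).
Proof.
rewrite /hdist !cabsE pol_hform.
have h1 := hval_norm2 z; have h2 := hval_norm2 w.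
set a2 := norm2 (1 - _); set b2 := norm2 _.
have b20 : 0 <= b2 := norm2_ge0 _.
have abE : (1 - norm2 (hval z)) * (1 - norm2 (hval w)) = a2 - b2.
  rewrite /a2 /b2 /norm2; case: (hval z) (hval w) => [x y] [u v] /=; ring.
have ab0 : 0 < a2 - b2 by rewrite -abE mulr_gt0 // subr_gt0.
have a20 : 0 < a2 by lra.
rewrite abE -(sqr_sqrtr (ltW a20)) -(sqr_sqrtr b20) in ab0 *.
have a0 : 0 < Num.sqrt a2 by rewrite sqrtr_gt0.
have b0 : 0 <= Num.sqrt b2 by exact: sqrtr_ge0.
move: (Num.sqrt a2) (Num.sqrt b2) a0 b0 ab0 => a b a0 b0 ab0.
rewrite !sqrtr_sqr (gtr0_norm a0) (ger0_norm b0).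
have ab : 0 < a - b by move: ab0; rewrite !expr2; nra.
have q0 : 0 < (a + b) / (a - b) by rewrite divr_gt0 //; lra.
split; first by rewrite ln_ge0 // ler_pdivlMr //; lra.
rewrite expRN lnK ?posrE //; field.
by rewrite !gt_eqF // ; lra.
Qed.

Lemma hdist_eq_pol (R : realType) (z w z' w' : hplane R) :
  pol (hform z) (hform w) = pol (hform z') (hform w') -> hdist z w = hdist z' w'.
Proof.
have [d0 <-] := expR_hdist z w; have [d0' <-] := expR_hdist z' w'.
move: (hdist z w) (hdist z' w') d0 d0' => d d' d0 d0' h.
have ex (x : R) : 0 <= x -> 1 <= expR x by rewrite -expR0 ler_expR.
have e1 := ex d d0; have e2 := ex d' d0'; apply: expR_inj.
move: h; rewrite !expRN.
move: (expR d) (expR d') e1 e2 => u v u1 v1 h.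
have u0 : u != 0 by rewrite gt_eqF //; lra.
have v0 : v != 0 by rewrite gt_eqF //; lra.
(* [u + 1 / u] is injective on [[1, +oo)]: either [u = v], or [u * v = 1] and both are [1]. *)
have /eqP : (u - v) * (u * v - 1) = 0.
  have -> : (u - v) * (u * v - 1) = u * v * ((u + u^-1) - (v + v^-1)).
    by field; rewrite u0 v0.
  by rewrite h subrr mulr0.
rewrite mulf_eq0 subr_eq0 => /orP[/eqP //|/eqP uv].
have : (u - 1) * v = 0 by nra.
move/eqP; rewrite mulf_eq0 (negbTE v0) orbF => /eqP ?.
nra.
Qed.

Lemma geodesic_pol (R : realType) (gam : R -> hplane R) : geodesic_line gam ->
  forall s t, pol (hform (gam s)) (hform (gam t)) = expR (s - t) + expR (t - s).
Proof.
move=> gg s t; have [_ <-] := expR_hdist (gam s) (gam t); rewrite gg.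
have [st|ts] := leP 0 (s - t); first by rewrite ger0_norm // opprB.
by rewrite ltr0_norm // opprK opprB addrC.
Qed.

(** [pol] has Lorentzian signature and [X] is timelike, so its orthogonal complement is definite and
    contains no nonzero null vector. *)
Lemma pol_orthogonal (R : realType) (X Y : R * R * R) :
  0 < X.1.1 -> X.1.1 * X.2 - X.1.2 ^+ 2 = 1 -> pol Y X = 0 -> pol Y Y = 0 -> Y = 0.
Proof.
case: X Y => [[a b] c] [[u v] w]; rewrite /pol /= => a0 dt h1 h2.
have [uv0|uv0] := eqVneq (v, - u) (0, 0).
  case: uv0 => v0 /eqP; rewrite oppr_eq0 => /eqP u0.
  have /eqP : a * w = 0 by move: h1; rewrite u0 v0; lra.
  by rewrite mulf_eq0 gt_eqF //= => /eqP ->; rewrite u0 v0.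
have := @bil_pos R (a, b, c) (v, - u) a0 _ uv0; rewrite /= dt => /(_ ltr01).
rewrite /bil /=.
have -> : a * v * v + b * (v * - u + - u * v) + c * - u * - u =
   u * (w * a + u * c - 2 * v * b) - a * (u * w + w * u - 2 * v * v) / 2 by field.
rewrite (_ : w * a + u * c - 2 * v * b = 0); last by move: h1; lra.
by rewrite h2 !mulr0 mul0r subrr ltxx.
Qed.

Definition comb3 (R : realType) (u v : R) (P Q : R * R * R) : R * R * R :=
  (u * P.1.1 + v * Q.1.1, u * P.1.2 + v * Q.1.2, u * P.2 + v * Q.2).

Lemma pol_comb3 (R : realType) (u v : R) (P Q X : R * R * R) :
  pol (comb3 u v P Q) X = u * pol P X + v * pol Q X.
Proof. by rewrite /pol /comb3 /=; ring. Qed.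

Lemma polC (R : realType) (X Y : R * R * R) : pol X Y = pol Y X.
Proof. by rewrite /pol; ring. Qed.

Lemma bil_comb3 (R : realType) (u v : R) (P Q : R * R * R) p q :
  bil (comb3 u v P Q) p q = u * bil P p q + v * bil Q p q.
Proof. by rewrite /bil /comb3 /=; ring. Qed.

Lemma comb3_sub_eq0 (R : realType) (X Y : R * R * R) : comb3 1 (-1) X Y = 0 -> X = Y.
Proof.
by case: X Y => [[a b] c] [[a' b'] c'] [h1 h2 h3]; congr (_, _, _); lra.
Qed.

(* In the hyperboloid model a geodesic is [exp(t) P + exp(-t) Q] with [P], [Q] null. *)
Lemma geodesic_form (R : realType) (gam : R -> hplane R) : geodesic_line gam ->
  exists P Q, [/\ pol P P = 0, pol Q Q = 0, pol P Q = 1 &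
    forall t, hform (gam t) = comb3 (expR t) (expR (- t)) P Q].
Proof.
move=> gg; have gp := geodesic_pol gg.
pose E : R := expR 1.
have E1 : 1 < E by rewrite /E expR_gt1.
have E0 : E != 0 by rewrite gt_eqF //; lra.
have EE : E ^+ 2 - 1 != 0 by rewrite subr_eq0 gt_eqF // expr2; nra.
pose X0 := hform (gam 0); pose X1 := hform (gam 1).
have p00 : pol X0 X0 = 2 by rewrite gp subrr expR0; ring.
have p11 : pol X1 X1 = 2 by rewrite gp subrr expR0; ring.
have p01 : pol X0 X1 = E + E^-1 by rewrite gp sub0r subr0 expRN addrC.
have p10 : pol X1 X0 = E + E^-1 by rewrite polC.
pose k := (E - E^-1)^-1.
(* The solution of [P + Q = X0] and [E P + Q / E = X1]. *)
pose P := comb3 (- (k / E)) k X0 X1; pose Q := comb3 (k * E) (- k) X0 X1.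
have pX X : pol P X = - (k / E) * pol X0 X + k * pol X1 X by exact: pol_comb3.
have qX X : pol Q X = (k * E) * pol X0 X + (- k) * pol X1 X by exact: pol_comb3.
have kE : k = E / (E ^+ 2 - 1) by rewrite /k; field; rewrite EE E0.
have PP : pol P P = 0.
  by rewrite pX (polC X0) (polC X1) !pX p00 p01 p10 p11 kE; field; rewrite EE E0.
have QQ : pol Q Q = 0.
  by rewrite qX (polC X0) (polC X1) !qX p00 p01 p10 p11 kE; field; rewrite EE E0.
have PQ : pol P Q = 1.
  by rewrite pX (polC X0) (polC X1) !qX p00 p01 p10 p11 kE; field; rewrite EE E0.
exists P, Q; split => // t.
pose u := expR t.
have u0 : u != 0 by rewrite gt_eqF // expR_gt0.
rewrite expRN -/u; set X := hform _.
have p0X : pol X0 X = u + u^-1 by rewrite gp sub0r subr0 expRN addrC.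
have p1X : pol X1 X = E / u + u / E by rewrite gp !expRD !expRN.
have pPX : pol P X = u^-1.
  by rewrite pX p0X p1X kE; field; rewrite EE E0 u0.
have pQX : pol Q X = u.
  by rewrite qX p0X p1X kE; field; rewrite EE E0 u0.
have pP0 : pol P X0 = 1.
  by rewrite pX p00 p10 kE; field; rewrite EE E0.
have pQ0 : pol Q X0 = 1.
  by rewrite qX p00 p10 kE; field; rewrite EE E0.
(* The difference of the two sides is null and orthogonal to [X0], hence zero. *)
pose Y := comb3 1 (-1) X (comb3 u u^-1 P Q).
have YX Z : pol Y Z = pol X Z - (u * pol P Z + u^-1 * pol Q Z).
  by rewrite /Y !pol_comb3; ring.
have Y0 : Y = 0.
  apply: (@pol_orthogonal _ X0); rewrite ?hform_pos ?hform_det //.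
    by rewrite YX (polC X) p0X pP0 pQ0; ring.
  have XX : pol X X = 2 by rewrite gp subrr expR0; ring.
  rewrite YX !(polC _ Y) !YX XX (polC X P) (polC X Q) pPX pQX PP QQ PQ (polC Q) PQ.
  by field.
exact: comb3_sub_eq0 Y0.
Qed.

Lemma bil_ext (R : realType) (p q : R * R) (X Y : R * R * R) : det2 p q != 0 ->
  bil X p p = bil Y p p -> bil X p q = bil Y p q -> bil X q q = bil Y q q -> X = Y.
Proof.
move=> d0 h1 h2 h3.
have pb : pullback p q X = pullback p q Y by rewrite /pullback h1 h2 h3.
have e v w : bil X v w = bil Y v w.
  by rewrite -(inv_lmapK v d0) -(inv_lmapK w d0) -!bil_pullback pb.
have a := e (1, 0) (1, 0); have b := e (1, 0) (0, 1); have c := e (0, 1) (0, 1).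
case: X Y a b c {h1 h2 h3 pb e} => [[a b] c] [[a' b'] c']; rewrite /bil /= => h1 h2 h3.
by congr (_, _, _); lra.
Qed.

Lemma null_form_kernel (R : realType) (P : R * R * R) : pol P P = 0 -> P <> 0 ->
  exists k, k != (0, 0) /\ forall v, bil P k v = 0.
Proof.
case: P => [[a b] c]; rewrite /pol /= => h n0.
have hh : a * c = b * b by lra.
have [a0|a0] := eqVneq a 0.
  have b0 : b = 0.
    by apply/eqP; have /eqP := hh; rewrite a0 mul0r eq_sym mulf_eq0 orbb.
  have c0 : c != 0 by apply/eqP => c0; apply: n0; rewrite a0 b0 c0.
  exists (c, 0); split=> [|v]; first by apply: contra_neq c0 => -[].
  by rewrite /bil /= a0 b0; ring.
exists (b, - a); split=> [|v].
  by apply: contra_neq a0 => -[_ /eqP]; rewrite oppr_eq0 => /eqP.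
rewrite /bil /=.
have -> : a * b * v.1 + b * (b * v.2 + - a * v.1) + c * - a * v.2 = (b * b - a * c) * v.2 by ring.
by rewrite hh subrr mul0r.
Qed.

(** The null forms [P] and [Q] of the parametrization have rank one; their kernels are the two ideal
    endpoints. *)
Lemma geodesic_range (R : realType) (gam : R -> hplane R) : geodesic_line gam ->
  exists p q, det2 p q != 0 /\ range gam = [set z | bil (hform z) p q = 0].
Proof.
move=> /geodesic_form[P [Q [PP QQ PQ gE]]].
have [|p [p0 hp]] := null_form_kernel PP.
  by move=> P0; move: PQ; rewrite P0 /pol /= !mul0r mulr0 mul0r subr0 addr0 => /eqP; rewrite eq_sym oner_eq0.
have [|q [q0 hq]] := null_form_kernel QQ.
  by move=> Q0; move: PQ; rewrite Q0 /pol /= !mulr0 subr0 addr0 => /eqP; rewrite eq_sym oner_eq0.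
have bE t v w : bil (hform (gam t)) v w = expR t * bil P v w + expR (- t) * bil Q v w.
  by rewrite gE bil_comb3.
have posz (z : hplane R) (v : R * R) : v != (0, 0) -> 0 < bil (hform z) v v.
  by move=> v0; apply: bil_pos; rewrite ?hform_pos ?hform_det.
have Qqp : bil Q p q = 0 by rewrite -(hq p) /bil; ring.
have gram (X : R * R * R) : (bil X p p) * (bil X q q) - bil X p q ^+ 2 =
      det2 p q ^+ 2 * (X.1.1 * X.2 - X.1.2 ^+ 2) by rewrite /bil /det2; ring.
have dpq : det2 p q != 0.
  apply/eqP => d0.
  have : (bil (hform (gam 0)) p p) * (bil (hform (gam 0)) q q) - bil (hform (gam 0)) p q ^+ 2 = 0.
    by rewrite gram d0 expr0n mul0r.
  have b0 : bil (hform (gam 0)) p q = 0 by rewrite bE hp Qqp !mulr0 addr0.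
  rewrite b0 expr0n subr0 => /eqP; rewrite mulf_eq0 => /orP[]; rewrite gt_eqF //; exact: posz.
exists p, q; split=> //; apply/seteqP; split=> [_ [t _ <-] /=|z /= hz].
  by rewrite bE hp Qqp !mulr0 addr0.
have Qp : 0 < bil Q p p.
  by have := posz (gam 0) p p0; rewrite bE hp oppr0 expR0 mulr0 add0r mul1r.
have Pq : 0 < bil P q q.
  by have := posz (gam 0) q q0; rewrite bE hq expR0 mulr0 addr0 mul1r.
have zq := posz z q q0; have zp := posz z p p0.
have g1 := gram (hform z); have g2 := gram (hform (gam 0)).
rewrite hform_det hz expr0n subr0 mulr1 in g1.
rewrite hform_det !bE hp Qqp hp hq !oppr0 !expR0 !mulr0 !addr0 expr0n subr0 add0r !mul1r mulr1 in g2.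
have u0 : 0 < bil (hform z) q q / bil P q q by rewrite divr_gt0.
(* The parameter is read off from the value at [q], where [Q] vanishes; the value at [p] then agrees
   because the Gram determinants do. *)
exists (ln (bil (hform z) q q / bil P q q)) => //; apply: hform_inj.
apply: (bil_ext dpq); rewrite bE ?hp ?hq ?Qqp ?hz ?mulr0 ?add0r ?addr0 //.
  rewrite expRN lnK ?posrE // invf_div mulrAC (mulrC _ (bil Q p p)) g2 -g1 mulfK //.
  by rewrite gt_eqF.
by rewrite lnK ?posrE // mulfVK // gt_eqF.
Qed.

(** With [c = p.1 + i p.2], the form of [g z] at [c] is the form of [z] at [conj a c + b conj c],
    where [a], [b] are the coefficients of [g]. The columns are the values of this real linear map
    at [1] and [i]. *)
Lemma disk_isometry_form (R : realType) (g : hplane R -> hplane R) : disk_isometry g ->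
  exists m1 m2, det2 m1 m2 = 1 /\ forall z p q,
    bil (hform (g z)) p q = bil (hform z) (lmap m1 m2 p) (lmap m1 m2 q).
Proof.
move=> [[a1 a2] [[b1 b2] [ab gE]]].
have {}ab : a1 ^+ 2 + a2 ^+ 2 - (b1 ^+ 2 + b2 ^+ 2) = 1.
  by move: ab; rewrite -!norm2_sqr /norm2 /= => -[].
exists (a1 + b1, b2 - a2), (a2 + b2, a1 - b1); split.
  by rewrite /det2 /= -ab; ring.
move=> z p q.
have := gE z; have := hval_norm2 z; have := hval_norm2 (g z).
rewrite /hform /norm2; case: (hval z) (hval (g z)) => [x y] [v w] /=.
set u1 := b1 * x + b2 * y + a1; set u2 := b1 * y - b2 * x - a2.
set n1 := a1 * x - a2 * y + b1; set n2 := a1 * y + a2 * x + b2.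
move=> hw hz E.
have UN : (u1 ^+ 2 + u2 ^+ 2) - (n1 ^+ 2 + n2 ^+ 2) = 1 - (x ^+ 2 + y ^+ 2).
  transitivity ((a1 ^+ 2 + a2 ^+ 2 - (b1 ^+ 2 + b2 ^+ 2)) * (1 - (x ^+ 2 + y ^+ 2))).
    by rewrite /u1 /u2 /n1 /n2; ring.
  by rewrite ab mul1r.
have U0 : 0 < u1 ^+ 2 + u2 ^+ 2.
  by have := sqr_ge0 n1; have := sqr_ge0 n2; lra.
have Un : u1 ^+ 2 + u2 ^+ 2 != 0 by rewrite gt_eqF.
have [vE wE] : v = (n1 * u1 + n2 * u2) / (u1 ^+ 2 + u2 ^+ 2) /\
               w = (n2 * u1 - n1 * u2) / (u1 ^+ 2 + u2 ^+ 2).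
  have e1 : b1 * x - - b2 * y + a1 = u1 by rewrite /u1; ring.
  have e2 : b1 * y + - b2 * x - a2 = u2 by rewrite /u2; ring.
  have e3 : a1 * x - a2 * y + b1 = n1 by [].
  have e4 : a1 * y + a2 * x + b2 = n2 by [].
  case: E => -> ->; rewrite e1 e2 e3 e4; split; field; exact: Un.
have d0 : 1 - (x ^+ 2 + y ^+ 2) != 0 by rewrite subr_eq0 gt_eqF.
have nE : 1 - (v ^+ 2 + w ^+ 2) = (1 - (x ^+ 2 + y ^+ 2)) / (u1 ^+ 2 + u2 ^+ 2).
  by rewrite -UN vE wE; field.
rewrite /bil /= nE; set D := 1 - (x ^+ 2 + y ^+ 2) in d0 *.
have Ai s : s ^+ 2 = 1 -> ((1 + s * v) ^+ 2 + w ^+ 2) / (D / (u1 ^+ 2 + u2 ^+ 2)) =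
    ((u1 + s * n1) ^+ 2 + (u2 + s * n2) ^+ 2) / D.
  move=> s1; transitivity ((1 + 2 * s * v + s ^+ 2 * v ^+ 2 + w ^+ 2) / (D / (u1 ^+ 2 + u2 ^+ 2))).
    by congr (_ / _); ring.
  rewrite s1 vE wE; transitivity ((u1 ^+ 2 + 2 * s * (n1 * u1 + n2 * u2) + s ^+ 2 * n1 ^+ 2 + u2 ^+ 2 + s ^+ 2 * n2 ^+ 2) / D).
    by rewrite s1; field; rewrite d0 Un.
  by congr (_ / _); ring.
have A1 := Ai 1 (expr1n _ _); rewrite !mul1r in A1; rewrite A1.
have s2 : (-1) ^+ 2 = 1 :> R by rewrite sqrrN expr1n.
have A2 := Ai (-1) s2; rewrite !mulN1r in A2; rewrite A2.
have -> : 2 * w / (D / (u1 ^+ 2 + u2 ^+ 2)) = 2 * (n2 * u1 - n1 * u2) / D.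
  by rewrite wE; field; rewrite d0 Un.
by rewrite /u1 /u2 /n1 /n2; ring.
Qed.

Lemma hplane_continuous_at (R : realType) (T : topologicalType) (f : T -> hplane R) (x : T) :
  (forall e : R, 0 < e -> \forall y \near x, pol (hform (f y)) (hform (f x)) < 2 + e) ->
  {for x, continuous f}.
Proof.
move=> h U /nbhs_hplane[e e0 hU]; have := h e e0; apply: filterS => y; exact: hU.
Qed.

Lemma geodesic_continuous (R : realType) (gam : R -> hplane R) :
  geodesic_line gam -> continuous gam.
Proof.
move=> gg t; apply: hplane_continuous_at => e e0.
have c : continuous (fun s : R => expR (s - t) + expR (t - s)).
  move=> s; apply: cvgD.
    apply: (@continuous_comp _ _ _ (fun s : R => s - t) expR); last exact: continuous_expR.
    by apply: cvgB; [exact: cvg_id|exact: cvg_cst].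
  apply: (@continuous_comp _ _ _ (fun s : R => t - s) expR); last exact: continuous_expR.
  by apply: cvgB; [exact: cvg_cst|exact: cvg_id].
have := c t => /cvgrPdist_lt /(_ e e0) /=; rewrite subrr expR0.
apply: filterS => s; rewrite (geodesic_pol gg) ltr_norml => /andP[h _].
by move: h; lra.
Qed.

Lemma disk_isometry_pol (R : realType) (g : hplane R -> hplane R) : disk_isometry g ->
  forall z w, pol (hform (g z)) (hform (g w)) = pol (hform z) (hform w).
Proof.
move=> /disk_isometry_form[m1 [m2 [dm hm]]] z w.
have e v : hform (g v) = pullback m1 m2 (hform v).
  have a := hm v (1, 0) (1, 0); have b := hm v (1, 0) (0, 1); have c := hm v (0, 1) (0, 1).
  rewrite /pullback [LHS]surjective_pairing (surjective_pairing (hform (g v)).1).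
  move: a b c; move: (hform (g v)) (hform v) => X Y.
  have -> : lmap m1 m2 (1, 0) = m1 by case: (m1) (m2) => [? ?] [? ?]; rewrite /lmap /=; congr pair; ring.
  have -> : lmap m1 m2 (0, 1) = m2 by case: (m1) (m2) => [? ?] [? ?]; rewrite /lmap /=; congr pair; ring.
  move=> <- <- <-; rewrite /bil /=; congr (_, _, _); ring.
have -> : pol (hform (g z)) (hform (g w)) = det2 m1 m2 ^+ 2 * pol (hform z) (hform w).
  by rewrite !e /pullback; move: (hform z) (hform w) => X Y; rewrite /pol /bil /det2 /=; ring.
by rewrite dm expr1n mul1r.
Qed.

Lemma disk_isometry_geodesic (R : realType) (g : hplane R -> hplane R) (gam : R -> hplane R) :
  disk_isometry g -> geodesic_line gam -> geodesic_line (g \o gam).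
Proof.
by move=> ig gg s t; rewrite -gg; apply: hdist_eq_pol; apply: disk_isometry_pol.
Qed.

(** * Orbits and limit sets *)

Lemma mobius_norm2 (R : realType) (a b z : R[i]) : `|a| ^+ 2 - `|b| ^+ 2 = 1 ->
  norm2 (b^*%C * z + a^*%C) - norm2 (a * z + b) = 1 - norm2 z.
Proof.
case: a b z => [a1 a2] [b1 b2] [x y].
rewrite -!norm2_sqr /norm2 /= => -[h].
transitivity ((a1 ^+ 2 + a2 ^+ 2 - (b1 ^+ 2 + b2 ^+ 2)) * (1 - (x ^+ 2 + y ^+ 2))); first by ring.
by rewrite h mul1r.
Qed.

Lemma mobius_denom_neq0 (R : realType) (a b : R[i]) (z : hplane R) :
  `|a| ^+ 2 - `|b| ^+ 2 = 1 -> b^*%C * hval z + a^*%C != 0 :> R[i].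
Proof.
move=> h; have := mobius_norm2 (hval z) h; have := hval_norm2 z.
have := norm2_ge0 (a * hval z + b).
have n00 : norm2 (0 : R[i]) = 0 by rewrite /norm2 /= expr0n /= addr0.
by move=> h1 h2 h3; apply/eqP => e; move: h3; rewrite e n00; lra.
Qed.

Lemma mobius_exists (R : realType) (a b : R[i]) : `|a| ^+ 2 - `|b| ^+ 2 = 1 ->
  exists g : hplane R -> hplane R,
    forall z, hval (g z) = (a * hval z + b) / (b^*%C * hval z + a^*%C) :> R[i].
Proof.
move=> h.
have ex (z : hplane R) : exists w : hplane R,
    hval w = (a * hval z + b) / (b^*%C * hval z + a^*%C) :> R[i].
  apply: hval_surj; have d0 := mobius_denom_neq0 z h.
  have n0 : 0 < norm2 (b^*%C * hval z + a^*%C).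
    rewrite lt_def norm2_ge0 andbT; apply: contra_neq d0 => /norm2_eq0.
    exact.
  have E := norm2M ((a * hval z + b) / (b^*%C * hval z + a^*%C)) (b^*%C * hval z + a^*%C).
  rewrite mulfVK // in E.
  rewrite -(ltr_pM2r n0) mul1r -E.
  by have := mobius_norm2 (hval z) h; have := hval_norm2 z; lra.
by have [g hg] := choice ex; exists g.
Qed.

Lemma disk_isometry_comp (R : realType) (g h : hplane R -> hplane R) :
  disk_isometry g -> disk_isometry h -> disk_isometry (g \o h).
Proof.
move=> [a [b [ab gE]]] [c [d [cd hE]]].
exists (a * c + b * d^*%C), (a * d + b * c^*%C); split.
  move: ab cd; rewrite !sqr_normc !rmorphD !rmorphM /= !conjcK => ab cd.
  rewrite -[RHS]mulr1 -{1}ab -cd; ring.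
move=> z; rewrite /= gE hE.
have n1 := mobius_denom_neq0 z cd; have n2 := mobius_denom_neq0 (h z) ab.
rewrite hE in n2.
rewrite !rmorphD !rmorphM /= !conjcK.
move: n1 n2; move: (hval z) (a^*%C) (b^*%C) (c^*%C) (d^*%C) => w a' b' c' d' n1 n2.
have n3 : b' * (c * w + d) + a' * (d' * w + c') != 0.
  have -> : b' * (c * w + d) + a' * (d' * w + c') =
    (b' * ((c * w + d) / (d' * w + c')) + a') * (d' * w + c') by field.
  by rewrite mulf_neq0.
have n4 : (a' * d' + b' * c) * w + (a' * c' + b' * d) != 0.
  by rewrite (_ : _ + _ = b' * (c * w + d) + a' * (d' * w + c')) //; ring.
by field; rewrite n4 n1.
Qed.

Lemma disk_isometry_inv (R : realType) (g : hplane R -> hplane R) : disk_isometry g ->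
  exists h, [/\ disk_isometry h, cancel g h & cancel h g].
Proof.
move=> [a [b [ab gE]]].
have ab' : `|a^*%C : R[i]| ^+ 2 - `|- b : R[i]| ^+ 2 = 1 by rewrite normrN normcJ.
have [h hE] := mobius_exists ab'; exists h; split.
- by exists a^*%C, (- b).
- move=> z; apply: hval_inj; rewrite hE gE rmorphN /= conjcK.
  have n1 := mobius_denom_neq0 z ab; have n2 := mobius_denom_neq0 (g z) ab'.
  rewrite gE rmorphN /= conjcK in n2.
  move: ab; rewrite !sqr_normc.
  move: n1 n2; move: (hval z) (a^*%C) (b^*%C) => w a' b' n1 n2 ab.
  have E1 : a' * ((a * w + b) / (b' * w + a')) + - b = w / (b' * w + a').
    transitivity ((a * a' - b * b') * w / (b' * w + a')); first by field.
    by rewrite ab mul1r.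
  have E2 : - b' * ((a * w + b) / (b' * w + a')) + a = 1 / (b' * w + a').
    by rewrite -ab; field.
  by rewrite E1 E2; field.
- move=> z; apply: hval_inj; rewrite gE hE rmorphN /= conjcK.
  have n1 := mobius_denom_neq0 z ab'; have n2 := mobius_denom_neq0 (h z) ab.
  rewrite hE rmorphN /= conjcK in n1 n2.
  move: ab; rewrite !sqr_normc.
  move: n1 n2; move: (hval z) (a^*%C) (b^*%C) => w a' b' n1 n2 ab.
  have E1 : a * ((a' * w + - b) / (- b' * w + a)) + b = w / (- b' * w + a).
    transitivity ((a * a' - b * b') * w / (- b' * w + a)); first by field.
    by rewrite ab mul1r.
  have E2 : b' * ((a' * w + - b) / (- b' * w + a)) + a' = 1 / (- b' * w + a).
    by rewrite -ab; field.
  by rewrite E1 E2; field.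
Qed.

Lemma deck_group_comp (R : realType) (X : riemannSurface R) (p : hplane R -> X) g h :
  deck_group p g -> deck_group p h -> deck_group p (g \o h).
Proof.
move=> [ig pg] [ih ph]; split; first exact: disk_isometry_comp.
by rewrite compA pg ph.
Qed.

Lemma deck_group_inv (R : realType) (X : riemannSurface R) (p : hplane R -> X) g :
  deck_group p g -> exists h, [/\ deck_group p h, cancel g h & cancel h g].
Proof.
move=> [ig pg]; have [h [ih gh hg]] := disk_isometry_inv ig.
exists h; split=> //; split=> //.
by apply/funext => z; have := congr1 (fun f => f (h z)) pg; rewrite /= hg => <-.
Qed.

(* Orbits of different points have the same limit points: [|g z - g w|^2] is
   [O(1 - |g w|^2)] because [g] preserves the hyperbolic distance. *)
Lemma orbit_limit_base (R : realType) (G : set (hplane R -> hplane R)) (xi : R[i]^o) z :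
  (forall g, G g -> disk_isometry g) -> ideal_boundary [set g z | g in G] xi ->
  forall z1 z2 e, 0 < e -> exists g, [/\ G g, norm2 (hval (g z1) - xi) < e
    & norm2 (hval (g z2) - xi) < e].
Proof.
move=> Giso [xi1 cl] z1 z2 e e0.
have nxi : norm2 xi = 1.
  move: xi1 => /= xi1; have := norm2_sqr xi; rewrite xi1 expr1n.
  by move=> /(congr1 (@complex.Re R)).
(* By invariance, [|g w - g z|^2 = k w (1 - |g w|^2) (1 - |g z|^2)] for all [g] in [G]. *)
pose k w := (pol (hform w) (hform z) - 2) / 4.
have kge w : 0 <= k w.
  rewrite /k pol_hform addrAC subrr add0r divr_ge0 // divr_ge0 //.
    by rewrite mulr_ge0 // norm2_ge0.
  by rewrite mulr_ge0 // subr_ge0 ltW // hval_norm2.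
pose K := k z1 + k z2 + 1.
have K1 : 1 <= K by rewrite /K; have := kge z1; have := kge z2; lra.
pose d := Num.min 1 (e / (8 * K)).
have d0 : 0 < d by rewrite lt_min ltr01 divr_gt0 // mulr_gt0 //; lra.
have d1 : d <= 1 by rewrite ge_min lexx.
have dK : d * (8 * K) <= e.
  by rewrite -ler_pdivlMr; [rewrite ge_min lexx orbT|rewrite mulr_gt0 //; lra].
have [_ [[_ [g Gg <-] <-] hw]] := (closure_norm2 _ _).1 cl (d ^+ 2) (exprn_gt0 2 d0).
have near w : k w <= K -> norm2 (hval (g w) - xi) < e.
  move=> kK.
  have iso := disk_isometry_pol (Giso _ Gg) w z.
  have := pol_hform (g w) (g z); rewrite iso.
  have := hval_norm2 (g w); have := hval_norm2 (g z); have := norm2_ge0 (hval (g w)).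
  have kw := kge w.
  move: hw nxi kK kw; rewrite /k; move: (pol (hform w) (hform z)) => P.
  rewrite /norm2; case: (hval (g z)) (hval (g w)) (xi) => [a b] [u v] [s t] /=.
  move=> hw nxi kK kw n0 h1 h2 E.
  set N1 := u ^+ 2 + v ^+ 2 in n0 h2 E; set N2 := a ^+ 2 + b ^+ 2 in h1 E.
  have E' : (u - a) ^+ 2 + (v - b) ^+ 2 = (P - 2) / 4 * ((1 - N1) * (1 - N2)).
    by rewrite E; field; rewrite !subr_eq0 !gt_eqF.
  have e1 : 1 - N2 <= 2 * d.
    have : 0 <= (d * s + (a - s)) ^+ 2 + (d * t + (b - t)) ^+ 2.
      by rewrite addr_ge0 ?sqr_ge0.
    have -> : (d * s + (a - s)) ^+ 2 + (d * t + (b - t)) ^+ 2 =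
      d ^+ 2 * (s ^+ 2 + t ^+ 2) + d * (N2 - (s ^+ 2 + t ^+ 2))
        + (1 - d) * ((a - s) ^+ 2 + (b - t) ^+ 2) by rewrite /N2; ring.
    rewrite nxi => h.
    have : (1 - d) * ((a - s) ^+ 2 + (b - t) ^+ 2) <= 1 * d ^+ 2.
      by apply: ler_pM; [lra|rewrite addr_ge0 ?sqr_ge0|lra|exact: ltW].
    move=> h'; have : d * (1 - N2) <= d * (2 * d) by move: h h'; rewrite !expr2; lra.
    by rewrite ler_pM2l.
  have e2 : (1 - N1) * (1 - N2) <= 2 * d by nra.
  have e3 : (P - 2) / 4 * ((1 - N1) * (1 - N2)) <= K * (2 * d).
    by apply: ler_pM => //; nra.
  have e4 : (u - s) ^+ 2 + (v - t) ^+ 2 <= 2 * ((u - a) ^+ 2 + (v - b) ^+ 2)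
      + 2 * ((a - s) ^+ 2 + (b - t) ^+ 2).
    have := sqr_ge0 ((u - a) - (a - s)); have := sqr_ge0 ((v - b) - (b - t)).
    by rewrite !expr2; lra.
  have e5 : d ^+ 2 <= d * K by rewrite expr2 ler_pM2l //; lra.
  by rewrite E' in e4; lra.
by exists g; split=> //; apply: near; rewrite /K; have := kge z1; have := kge z2; lra.
Qed.

(** * Half-spaces and the convex hull of an orbit *)

Definition lin3 (R : realType) (c X : R * R * R) : R :=
  c.1.1 * X.1.1 + c.1.2 * X.1.2 + c.2 * X.2.

(* The closed convex hull of the orbit of [o] in the hyperboloid model. *)
Definition orbit_hull (R : realType) (G : set (hplane R -> hplane R)) (o : hplane R) :
  set (hplane R) :=
  [set z | forall c, (forall g, G g -> 0 <= lin3 c (hform (g o))) -> 0 <= lin3 c (hform z)].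

Lemma orbit_hull_invariant (R : realType) (G : set (hplane R -> hplane R)) o g z :
  (forall g h, G g -> G h -> G (g \o h)) -> G g -> disk_isometry g ->
  orbit_hull G o z -> orbit_hull G o (g z).
Proof.
move=> Gc Gg /disk_isometry_form[m1 [m2 [_ hm]]] hz c hc.
(* The functional [c] composed with [g]; half-spaces containing the orbit pull back to such
   half-spaces. *)
pose c' : R * R * R :=
  (c.1.1 * m1.1 ^+ 2 + c.1.2 * m1.1 * m2.1 + c.2 * m2.1 ^+ 2,
   2 * c.1.1 * m1.1 * m1.2 + c.1.2 * (m1.1 * m2.2 + m1.2 * m2.1) + 2 * c.2 * m2.1 * m2.2,
   c.1.1 * m1.2 ^+ 2 + c.1.2 * m1.2 * m2.2 + c.2 * m2.2 ^+ 2).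
have cE w : lin3 c (hform (g w)) = lin3 c' (hform w).
  have := hm w (1, 0) (1, 0); have := hm w (1, 0) (0, 1); have := hm w (0, 1) (0, 1).
  move: (hform (g w)) (hform w) => X Y; rewrite /bil /lmap /=.
  rewrite !(mulr0, mul0r, mulr1, mul1r, addr0, add0r) => e3 e2 e1.
  by rewrite /lin3 e1 e2 e3 /c' /=; ring.
rewrite cE; apply: hz => h Gh; rewrite -cE.
exact: hc (Gc _ _ Gg Gh).
Qed.

Lemma Re_continuous (R : realType) : continuous (@complex.Re R : R[i]^o -> R).
Proof.
move=> z U /nbhs_ballP[e /= e0 hU]; apply: (nbhs_norm2 _ _).2; exists (e ^+ 2); first exact: exprn_gt0.
move=> w hw; apply: hU; move: hw; rewrite -ball_normE /= /norm2; case: z w => [a b] [c d] /= h.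
rewrite distrC -ltr_sqr ?nnegrE ?(ltW e0) // real_normK ?num_real //.
by apply: le_lt_trans h; rewrite lerDl sqr_ge0.
Qed.

Lemma Im_continuous (R : realType) : continuous (@complex.Im R : R[i]^o -> R).
Proof.
move=> z U /nbhs_ballP[e /= e0 hU]; apply: (nbhs_norm2 _ _).2; exists (e ^+ 2); first exact: exprn_gt0.
move=> w hw; apply: hU; move: hw; rewrite -ball_normE /= /norm2; case: z w => [a b] [c d] /= h.
rewrite distrC -ltr_sqr ?nnegrE ?(ltW e0) // real_normK ?num_real //.
by apply: le_lt_trans h; rewrite lerDr sqr_ge0.
Qed.

Lemma lin3_hform_ge0 (R : realType) (c : R * R * R) (z : hplane R) :
  let x := complex.Re (hval z) in let y := complex.Im (hval z) in
  (0 <= lin3 c (hform z)) =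
  (0 <= c.1.1 * ((1 + x) * (1 + x) + y * y) + c.1.2 * (2 * y) + c.2 * ((1 - x) * (1 - x) + y * y)).
Proof.
move=> x y; have d0 : 0 < 1 - norm2 (hval z) by rewrite subr_gt0 hval_norm2.
rewrite -(pmulr_rge0 _ d0); congr (0 <= _).
by rewrite /lin3 /hform /= -/x -/y; field; rewrite gt_eqF.
Qed.

Lemma continuous_quadratic (R : realType) (T : topologicalType) (c : R * R * R) (x y : T -> R) :
  continuous x -> continuous y ->
  continuous (fun z => c.1.1 * ((1 + x z) * (1 + x z) + y z * y z) + c.1.2 * (2 * y z)
      + c.2 * ((1 - x z) * (1 - x z) + y z * y z)).
Proof.
move=> xc yc z.
by repeat first [exact: cvg_cst | exact: xc | exact: yc | apply: cvgD | apply: cvgN | apply: cvgM].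
Qed.

Lemma orbit_hull_closed (R : realType) (G : set (hplane R -> hplane R)) o :
  closed (orbit_hull G o).
Proof.
have -> : orbit_hull G o = \bigcap_(c in [set c | forall g, G g -> 0 <= lin3 c (hform (g o))])
    [set z | 0 <= lin3 c (hform z)] by [].
apply: closed_bigI => c _.
have hc : continuous (@hval R) by exact: initial_continuous.
have xc : continuous (fun z : hplane R => complex.Re (hval z)).
  by move=> z; apply: continuous_comp; [exact: hc|exact: Re_continuous].
have yc : continuous (fun z : hplane R => complex.Im (hval z)).
  by move=> z; apply: continuous_comp; [exact: hc|exact: Im_continuous].
have Fc := continuous_quadratic (c := c) xc yc.
have -> : [set z | 0 <= lin3 c (hform z)] = (fun z : hplane R =>
    let x := complex.Re (hval z) in let y := complex.Im (hval z) in
    c.1.1 * ((1 + x) * (1 + x) + y * y) + c.1.2 * (2 * y)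
      + c.2 * ((1 - x) * (1 - x) + y * y)) @^-1` [set t | 0 <= t].
  by apply/seteqP; split=> z /=; rewrite lin3_hform_ge0.
by apply: preimage_closed; [move=> z _; exact: Fc|exact: closed_ge].
Qed.

(** Along a geodesic a linear functional is [expR t] times a monotone function of [t], so it is
    nonnegative between two points where it is. *)
Lemma orbit_hull_convex (R : realType) (G : set (hplane R -> hplane R)) o :
  hconvex (orbit_hull G o).
Proof.
move=> gam s t u gg /andP[su ut] hs ht c hc.
have := hs c hc; have := ht c hc; have [P [Q [_ _ _ gE]]] := geodesic_form gg.
have lE r : (0 <= lin3 c (hform (gam r))) = (0 <= lin3 c P + expR (- 2 * r) * lin3 c Q).
  rewrite gE -[RHS](pmulr_rge0 _ (expR_gt0 r)); congr (0 <= _).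
  have -> : expR (- r) = expR r * expR (- 2 * r) by rewrite -expRD; congr expR; ring.
  by rewrite /lin3 /comb3 /=; ring.
rewrite !lE => h1 h2.
have [q0|q0] := leP 0 (lin3 c Q).
  apply: (le_trans h1); rewrite lerD2l ler_wpM2r // ler_expR; lra.
apply: (le_trans h2); rewrite lerD2l ler_wnM2r ?(ltW q0) // ler_expR; lra.
Qed.

Lemma orbit_hull_boundary (R : realType) (G : set (hplane R -> hplane R)) o :
  (forall g, G g -> disk_isometry g) ->
  ideal_boundary (orbit_hull G o) = limit_set G.
Proof.
move=> Giso; apply/seteqP; split=> [xi [xi1 cl]|xi [z _ hxi]]; last first.
  have lim := orbit_limit_base Giso hxi o o; case: hxi => xi1 _; split=> //.
  apply/closure_norm2 => e e0; have [g [Gg h _]] := lim e e0.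
  by exists (hval (g o)); split=> //; exists (g o) => // c; apply.
exists o => //; split=> //; apply/closure_norm2 => e e0.
apply: contrapT => no.
have nxi : norm2 xi = 1.
  move: xi1 => /= xi1; have := norm2_sqr xi; rewrite xi1 expr1n.
  by move=> /(congr1 (@complex.Re R)).
have far g : G g -> e <= norm2 (hval (g o) - xi).
  move=> Gg; rewrite leNgt; apply/negP => h; apply: no.
  by exists (hval (g o)); split=> //; exists (g o) => //; exists g.
(* The half-space is given by [e / 2 (1 + |w|^2) <= |w - xi|^2]. As [|w| < 1], it contains all [w]
   with [|w - xi|^2 >= e], so the orbit, and none with [|w - xi|^2 < e / 2]. *)
pose c : R * R * R := ((1 - e / 2) / 2 - complex.Re xi / 2, - complex.Im xi,
   (1 - e / 2) / 2 + complex.Re xi / 2).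
have cE w : (0 <= lin3 c (hform w)) =
    (e / 2 * (1 + norm2 (hval w)) <= norm2 (hval w - xi)).
  rewrite lin3_hform_ge0 -[RHS]subr_ge0; congr (0 <= _).
  move: nxi; rewrite /c /norm2; case: (xi) (hval w) => [s t] [a b] /= nxi.
  have -> : (a - s) ^+ 2 + (b - t) ^+ 2 = a ^+ 2 + b ^+ 2 + 1 - 2 * (a * s + b * t).
    by move: nxi; rewrite !expr2; lra.
  by field.
have e2 : 0 < e / 2 by rewrite divr_gt0.
have [_ [[w Kw <-] hw]] := (closure_norm2 _ _).1 cl (e / 2) e2.
have : 0 <= lin3 c (hform w).
  apply: Kw => g /far h; rewrite cE; apply: le_trans h.
  have := hval_norm2 (g o); nra.
rewrite cE; have := norm2_ge0 (hval w); nra.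
Qed.

Lemma convex_hull_sub_orbit_hull (R : realType) (G : set (hplane R -> hplane R)) o :
  (forall g, G g -> disk_isometry g) ->
  convex_hull (limit_set G) `<=` orbit_hull G o.
Proof.
move=> Giso z; apply; split; last by [].
by split; [exact: orbit_hull_closed|exact: orbit_hull_convex|exact: orbit_hull_boundary].
Qed.

(** * Lifting leaves to the disk *)

(** [V] and [W] are the sheets through [z] and [w] over one evenly covered neighborhood. *)
Lemma covering_lifts (S T : topologicalType) (p : S -> T) (z w : S) :
  covering_map p -> p z = p w -> exists V W, [/\ nbhs z V, nbhs w W,
    forall v v', V v -> V v' -> p v = p v' -> v = v' &
    V `&` W !=set0 -> V = W].
Proof.
move=> [_ _ /(_ (p z))[U [sheets [[oU Uz] hom disj pU]]]] pzw.
have [V sV Vz] : (\bigcup_(V in sheets) V) z by rewrite -pU.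
have [W sW Ww] : (\bigcup_(V in sheets) V) w by rewrite -pU /= -pzw.
have [oV [f [_ _ [pf _] _ _]]] := hom V sV; have [oW _] := hom W sW.
exists V, W; split; [exact: open_nbhs_nbhs|exact: open_nbhs_nbhs| |exact: disj].
move=> v v' Vv Vv' e.
by rewrite -(pf v (mem_set Vv)) -(pf v' (mem_set Vv')) e.
Qed.

(** The lifts agree on an open set because [p] is injective on sheets, and this set is closed
    because different sheets are disjoint. *)
Lemma unique_lifting (R : realType) (S T : topologicalType) (p : S -> T) (a b : R -> S) s :
  covering_map p -> continuous a -> continuous b -> p \o a = p \o b -> a s = b s -> a = b.
Proof.
move=> cov ca cb pab hs.
have pE t : p (a t) = p (b t) := congr1 (fun f => f t) pab.
pose E := [set t | a t = b t].
have oE : open E.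
  rewrite openE => t Et; have [V [W [Vz Ww inj _]]] := covering_lifts cov (erefl (p (a t))).
  have n1 : nbhs t (a @^-1` V) := ca t V Vz.
  have n2 : nbhs t (b @^-1` V) by apply: cb; rewrite -Et.
  apply: filterS2 n1 n2 => u /= h1 h2; exact: inj.
have cE : closed E.
  rewrite -openC openE => t /= nE; have [V [W [Vz Ww inj eqVW]]] := covering_lifts cov (pE t).
  have n1 : nbhs t (a @^-1` V) := ca t V Vz.
  have n2 : nbhs t (b @^-1` W) := cb t W Ww.
  apply: filterS2 n1 n2 => u /= h1 h2 Eu; apply: nE.
  have VW : V = W by apply: eqVW; exists (a u); split=> //; rewrite Eu.
  apply: inj => //; first exact: nbhs_singleton.
  by rewrite VW; apply: nbhs_singleton.
have cR : connected [set: R] by apply/connected_intervalP.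
have ET : E = setT.
  by apply: cR; [exists s|exists E; rewrite ?setTI|exists E; rewrite ?setTI].
by apply/funext => t; have : E t by rewrite ET.
Qed.

(** * Points of a geodesic and its ideal endpoints *)

Lemma form_exists (R : realType) (p q : R * R) (al be : R) :
  0 < al -> 0 < be -> al * be = det2 p q ^+ 2 ->
  exists z : hplane R, [/\ bil (hform z) p p = al, bil (hform z) p q = 0 & bil (hform z) q q = be].
Proof.
move=> a0 b0 ab.
have [D DE] : exists D, D = det2 p q by eexists.
rewrite -DE in ab; have D2 : 0 < D ^+ 2 by rewrite -ab mulr_gt0.
have D0 : D != 0 by apply/eqP => h; move: D2; rewrite h expr0n ltxx.
(* The form that is diagonal with entries [al], [be] in the basis [p], [q]; the condition on
   [al * be] makes its determinant 1. *)
pose X : R * R * R := ((al * q.2 ^+ 2 + be * p.2 ^+ 2) / D ^+ 2,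
  - (al * q.1 * q.2 + be * p.1 * p.2) / D ^+ 2,
  (al * q.1 ^+ 2 + be * p.1 ^+ 2) / D ^+ 2).
have X1 : X.1.1 * X.2 - X.1.2 ^+ 2 = 1.
  transitivity (al * be * (det2 p q ^+ 2) / D ^+ 2 / D ^+ 2).
    by rewrite /X /det2 /=; ring.
  by rewrite -DE ab mulfK ?divff // gt_eqF.
have X0 : 0 < X.1.1.
  rewrite lt_def; apply/andP; split.
    by apply/eqP => h; move: X1; rewrite h mul0r sub0r => h'; have := sqr_ge0 X.1.2; lra.
  rewrite /X /=; apply: divr_ge0; last exact: ltW.
  by apply: addr_ge0; apply: mulr_ge0; rewrite ?sqr_ge0 ?(ltW a0) ?(ltW b0).
have [z zE] := hform_surj X0 X1.
have bE v w : bil (hform z) v w =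
    (al * (det2 v q * det2 w q) + be * (det2 p v * det2 p w)) / D ^+ 2.
  by rewrite zE /bil /X /det2 /=; ring.
have d0 v : det2 v v = 0 by rewrite /det2; ring.
exists z; rewrite !bE !d0 -!DE; split.
- by field.
- by rewrite !(mulr0, mul0r, addr0).
- by field.
Qed.

(* With [c = p.1 + i p.2] this is [- c / c^*], where the form [|c + z c^*|^2] vanishes. *)
Definition ideal_point (R : realType) (p : R * R) : R[i] :=
  Complex ((p.2 ^+ 2 - p.1 ^+ 2) / (p.1 ^+ 2 + p.2 ^+ 2))
          (- (2 * p.1 * p.2) / (p.1 ^+ 2 + p.2 ^+ 2)).

Lemma norm2_sub_ideal_point (R : realType) (p : R * R) (z : hplane R) :
  p.1 ^+ 2 + p.2 ^+ 2 != 0 ->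
  bil (hform z) p p * (1 - norm2 (hval z)) =
  (p.1 ^+ 2 + p.2 ^+ 2) * norm2 (hval z - ideal_point p).
Proof.
have := hval_norm2 z; rewrite /bil /hform /norm2 /ideal_point.
case: (hval z) => [x y] /= h n0.
by field; rewrite n0 subr_eq0 gt_eqF.
Qed.

Lemma norm2_ideal_pointB (R : realType) (p q : R * R) :
  p.1 ^+ 2 + p.2 ^+ 2 != 0 -> q.1 ^+ 2 + q.2 ^+ 2 != 0 ->
  norm2 (ideal_point p - ideal_point q) =
  4 * det2 p q ^+ 2 / ((p.1 ^+ 2 + p.2 ^+ 2) * (q.1 ^+ 2 + q.2 ^+ 2)).
Proof.
by move=> p0 q0; rewrite /norm2 /ideal_point /det2 /=; field; rewrite p0 q0.
Qed.

Lemma norm_ideal_point (R : realType) (p : R * R) :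
  p.1 ^+ 2 + p.2 ^+ 2 != 0 -> `|ideal_point p| = 1.
Proof.
move=> p0; rewrite normc_def -/(norm2 _).
have -> : norm2 (ideal_point p) = 1 by rewrite /norm2 /ideal_point /=; field.
by rewrite sqrtr1.
Qed.

Lemma sqr_sum_gt0 (R : realType) (p q : R * R) : det2 p q != 0 -> 0 < p.1 ^+ 2 + p.2 ^+ 2.
Proof.
move=> d; rewrite lt_def addr_ge0 ?sqr_ge0 // andbT.
apply: contra_neq d => /eqP; rewrite paddr_eq0 ?sqr_ge0 // !sqrf_eq0 => /andP[/eqP a /eqP b].
by rewrite /det2 a b !mul0r subrr.
Qed.

Lemma endpoint_ideal_boundary (R : realType) (K : set (hplane R)) (p q : R * R) :
  det2 p q != 0 -> [set z | bil (hform z) p q = 0] `<=` K ->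
  ideal_boundary K (ideal_point p : R[i]^o).
Proof.
move=> d sub; have pp := sqr_sum_gt0 d; have D2 : 0 < det2 p q ^+ 2 by rewrite exprn_even_gt0.
split; first by rewrite /=; apply: norm_ideal_point; rewrite gt_eqF.
apply/closure_norm2 => e e0.
(* This value at [p] selects a point of the geodesic within squared distance [e / 2] of the ideal
   point. *)
pose al := (p.1 ^+ 2 + p.2 ^+ 2) * (e / 2).
have a0 : 0 < al by rewrite mulr_gt0 // divr_gt0.
have [||z [z1 z2 _]] := @form_exists R p q al (det2 p q ^+ 2 / al) a0.
- by rewrite divr_gt0.
- by rewrite mulrC mulfVK // gt_eqF.
exists (hval z); split; first by exists z => //; apply: sub.
have := norm2_sub_ideal_point z (negbT (gt_eqF pp)); rewrite z1 /al -mulrA => /(mulfI (negbT (gt_eqF pp))) <-.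
have := norm2_ge0 (hval z); have := hval_norm2 z => h1 h2.
have : e / 2 * (1 - norm2 (hval z)) <= e / 2 * 1 by rewrite ler_pM2l ?divr_gt0 //; lra.
lra.
Qed.

(** * The lifted lamination *)

Section Lamination.
Context (R : realType) (X : riemannSurface R) (p : hplane R -> X).
Context (p_cov : hyperbolic_universal_covering p).
Context (lam : geodesic_lamination p) (gm : set X -> R -> hplane R).
Context (gmP : forall l, gl_leaves lam l ->
  [/\ geodesic_line (gm l), simple_curve (p \o gm l) & l = range (p \o gm l)]).

(** Lifts that meet project to the same leaf. As it is simple, the two parameters are equal or
    differ by a period, and unique lifting identifies the lifts up to this shift. *)
Lemma lifts_disjoint l l' g g' s t : gl_leaves lam l -> gl_leaves lam l' ->
  deck_group p g -> deck_group p g' -> g (gm l s) = g' (gm l' t) ->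
  range (g \o gm l) = range (g' \o gm l').
Proof.
move=> hl hl' [ig pg] [ig' pg'] e; have [cov _ _] := p_cov.
have pgE z : p (g z) = p z := congr1 (fun f => f z) pg.
have pgE' z : p (g' z) = p z := congr1 (fun f => f z) pg'.
have ll : l = l'.
  apply: (gl_disjoint hl hl'); exists (p (g (gm l s))).
  have [_ _ lE] := gmP hl; have [_ _ lE'] := gmP hl'; split.
    have : range (p \o gm l) (p (g (gm l s))) by exists s => //=; rewrite pgE.
    by rewrite -lE.
  have : range (p \o gm l') (p (g (gm l s))) by rewrite e; exists t => //=; rewrite pgE'.
  by rewrite -lE'.
subst l'; have [gg simp _] := gmP hl.
have cst : (p \o gm l) s = (p \o gm l) t by rewrite /= -pgE e pgE'.
have [T [st per]] : exists T, t = s + T /\ forall u, (p \o gm l) u = (p \o gm l) (u + T).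
  case: simp => [inj|[T T0 per]].
    by exists 0; split; [rewrite addr0; apply/esym/inj|move=> u; rewrite addr0].
  have [k tk] := (per s t).1 cst; exists (k%:~R * T); split=> // u.
  by apply/per; exists k.
have shift : geodesic_line (fun u => gm l (u + T)).
  by move=> u v; rewrite gg; congr `| _ |; ring.
have E : g \o gm l = g' \o (fun u => gm l (u + T)).
  apply: (unique_lifting (s := s) cov).
  - by apply: geodesic_continuous; apply: disk_isometry_geodesic.
  - by apply: geodesic_continuous; apply: (disk_isometry_geodesic ig' shift).
  - by apply/funext => u /=; rewrite pgE pgE'; apply: per.
  - by rewrite /= e st.
rewrite E; apply/seteqP; split=> [_ [u _ <-]|_ [u _ <-]] /=.
  by exists (u + T).
by exists (u - T) => //=; rewrite subrK.
Qed.

Definition leaf_endpoints (a b : R * R) : Prop :=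
  det2 a b != 0 /\ exists l g, [/\ gl_leaves lam l, deck_group p g &
    [set z | bil (hform z) a b = 0] = range (g \o gm l)].

Lemma leaf_through z : gl_support lam (p z) ->
  exists a b, leaf_endpoints a b /\ bil (hform z) a b = 0.
Proof.
rewrite gl_union => -[l hl]; have [gg _ lE] := gmP hl; rewrite lE => -[s _ /= ps].
have [_ _ /(_ _ _ ps)[g dg gs]] := p_cov.
have [a [b [d0 rE]]] := geodesic_range (disk_isometry_geodesic dg.1 gg).
exists a, b; split; first by split=> //; exists l, g.
have : range (g \o gm l) z by exists s.
by rewrite rE.
Qed.

Lemma leaf_sub_support a b z : leaf_endpoints a b -> bil (hform z) a b = 0 ->
  gl_support lam (p z).
Proof.
move=> [_ [l [g [hl [ig pg] rE]]]] hz.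
have : range (g \o gm l) z by rewrite -rE.
move=> [s _ <-]; rewrite gl_union; exists l => //; have [_ _ lE] := gmP hl.
have : range (p \o gm l) ((p \o g) (gm l s)) by exists s => //; rewrite pg.
by rewrite -lE.
Qed.

(** Crossing leaves would meet, hence coincide by [lifts_disjoint]; but the first contains points
    off the second. *)
Lemma leaves_do_not_cross a b c d : leaf_endpoints a b -> leaf_endpoints c d ->
  0 <= det2 a c * det2 b d * (det2 a d * det2 b c).
Proof.
move=> [ab [l [g [hl dg rE]]]] [cd [l' [g' [hl' dg' rE']]]].
rewrite leNgt; apply/negP => neg.
have ab2 : 0 < det2 a b ^+ 2 by rewrite exprn_even_gt0.
pose P := det2 c b * det2 d b; pose Q := det2 a c * det2 a d.
have PQ : P * Q < 0.
  have -> : P * Q = det2 a c * det2 b d * (det2 a d * det2 b c) by rewrite /P /Q /det2; ring.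
  exact: neg.
have Q0 : Q != 0 by apply/eqP => h; move: PQ; rewrite h mulr0 ltxx.
have P0 : P != 0 by apply/eqP => h; move: PQ; rewrite h mul0r ltxx.
have bE (Y : R * R * R) : det2 a b ^+ 2 * bil Y c d = bil Y a a * P + bil Y b b * Q +
    bil Y a b * (det2 c b * det2 a d + det2 d b * det2 a c).
  by rewrite /P /Q /bil /det2; ring.
(* the leaves meet where [bil Y a a / bil Y b b = - Q / P] *)
have point (k : R) : 0 < k -> exists z : hplane R, [/\ bil (hform z) a b = 0 &
    bil (hform z) a a = k * bil (hform z) b b].
  move=> k0; pose r := Num.sqrt k.
  have r0 : 0 < r by rewrite sqrtr_gt0.
  have r2 : r ^+ 2 = k by rewrite sqr_sqrtr ?ltW.
  pose D := `|det2 a b|; have D0 : 0 < D by rewrite normr_gt0.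
  have [||z [z1 z2 z3]] := @form_exists R a b (r * D) (D / r) (mulr_gt0 r0 D0).
  - by rewrite divr_gt0.
  - rewrite mulrC mulrA mulfVK ?gt_eqF // -expr2 real_normK ?num_real //.
  by exists z; split=> //; rewrite z1 z3 -r2; field; rewrite gt_eqF.
have k0 : 0 < - Q / P.
  have -> : - Q / P = - (P * Q) / P ^+ 2 by field.
  by rewrite divr_gt0 ?oppr_gt0 // exprn_even_gt0.
have [z [z1 z2]] := point _ k0.
have z3 : bil (hform z) c d = 0.
  apply: (mulfI (negbT (gt_eqF ab2))); rewrite bE z1 z2; field; exact: P0.
have [s _ gs] : range (g \o gm l) z by rewrite -rE.
have [t _ gt] : range (g' \o gm l') z by rewrite -rE'.
have rr := lifts_disjoint hl hl' dg dg' (etrans gs (esym gt)).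
(* Doubling the ratio gives a point of the first leaf where [bil _ c d] does not vanish. *)
have [w [w1 w2]] := point _ (mulr_gt0 (ltr0Sn R 1) k0).
have : [set z | bil (hform z) c d = 0] w by rewrite rE' -rr -rE.
move=> /= w3; have := bE (hform w); rewrite w1 w2 w3 !mulr0 mul0r addr0.
have b0 : b != (0, 0) by apply: contra_neq ab => ->; rewrite /det2 /= !mulr0 subrr.
have wb : 0 < bil (hform w) b b by apply: bil_pos; rewrite ?hform_pos ?hform_det.
have -> : 2 * (- Q / P) * bil (hform w) b b * P + bil (hform w) b b * Q =
  - (bil (hform w) b b * Q) by field.
by move/eqP; rewrite eq_sym oppr_eq0 mulf_eq0 (negbTE Q0) orbF gt_eqF.
Qed.
End Lamination.

(** A geodesic in the orbit hull ends at limit points. Near the ideal point of [a] one is away from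
    that of [b], so the form is small at [a] compared with [b]. *)
Lemma endpoint_limit (R : realType) (G : set (hplane R -> hplane R)) (o : hplane R) (a b : R * R)
    z1 z2 (e : R) :
  (forall g, G g -> disk_isometry g) -> det2 a b != 0 ->
  [set z | bil (hform z) a b = 0] `<=` orbit_hull G o -> 0 < e ->
  exists g, [/\ G g, bil (hform (g z1)) a a <= e * bil (hform (g z1)) b b &
    bil (hform (g z2)) a a <= e * bil (hform (g z2)) b b].
Proof.
move=> Giso d sub e0.
have dba : det2 b a != 0 by rewrite (_ : det2 b a = - det2 a b) ?oppr_eq0 // /det2; ring.
have aa := sqr_sum_gt0 d; have bb := sqr_sum_gt0 dba.
have an : a.1 ^+ 2 + a.2 ^+ 2 != 0 by rewrite gt_eqF.
have bn : b.1 ^+ 2 + b.2 ^+ 2 != 0 by rewrite gt_eqF.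
have := endpoint_ideal_boundary d sub; rewrite orbit_hull_boundary // => -[z _ lim].
pose r := norm2 (ideal_point a - ideal_point b).
have r0 : 0 < r.
  have D2 : 0 < det2 a b ^+ 2 by rewrite exprn_even_gt0.
  by rewrite /r norm2_ideal_pointB // divr_gt0 // mulr_gt0.
move: (a.1 ^+ 2 + a.2 ^+ 2) (b.1 ^+ 2 + b.2 ^+ 2) aa bb an bn
  (@norm2_sub_ideal_point R a) (@norm2_sub_ideal_point R b) => A B A0 B0 An Bn hA hB.
(* Within squared distance [r / 4] of one ideal point, the squared distance to the other is at least
   [r / 4]; the second bound accounts for the lengths of [a] and [b]. *)
pose k := Num.min (r / 4) (e * B * (r / 4) / A).
have k0 : 0 < k by rewrite lt_min !divr_gt0 ?mulr_gt0 // divr_gt0.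
have k1 : k <= r / 4 by rewrite ge_min lexx.
have k2 : A * k <= e * B * (r / 4).
  by rewrite mulrC -ler_pdivlMr // ge_min lexx orbT.
have [g [Gg g1 g2]] := orbit_limit_base Giso lim z1 z2 k0.
have near w : norm2 (hval w - ideal_point a) < k ->
    bil (hform w) a a <= e * bil (hform w) b b.
  move=> hw; have n0 : 0 < 1 - norm2 (hval w) by rewrite subr_gt0 hval_norm2.
  rewrite -(ler_pM2r n0) -mulrA hA // hB //.
  have : r <= 2 * norm2 (hval w - ideal_point a) + 2 * norm2 (hval w - ideal_point b).
    rewrite /r /norm2; case: (hval w) (ideal_point a) (ideal_point b) => [x y] [s t] [u v] /=.
    have := sqr_ge0 ((x - s) + (x - u)); have := sqr_ge0 ((y - t) + (y - v)).
    by rewrite !expr2; lra.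
  move=> h; have h' : r / 4 <= norm2 (hval w - ideal_point b) by lra.
  have l1 : A * norm2 (hval w - ideal_point a) <= A * k by rewrite ler_pM2l // ltW.
  apply: (le_trans l1); apply: (le_trans k2).
  by rewrite [X in _ <= X]mulrA ler_pM2l // mulr_gt0.
by exists g; split=> //; apply: near.
Qed.

(** * The lamination as a noncrossing system *)

Lemma lamination_noncrossing_system (R : realType) (X : riemannSurface R) (p : hplane R -> X)
    (lam : geodesic_lamination p) (gm : set X -> R -> hplane R) :
  hyperbolic_universal_covering p -> gl_support lam `<=` convex_core p ->
  (forall l, gl_leaves lam l ->
    [/\ geodesic_line (gm l), simple_curve (p \o gm l) & l = range (p \o gm l)]) ->
  noncrossing_system (@hform R) (leaf_endpoints lam gm) (deck_group p).
Proof.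
move=> p_cov core gmP; have [cov _ fibers] := p_cov.
have Giso g : deck_group p g -> disk_isometry g by case.
have n0 : norm2 (0 : R[i]) < 1 by rewrite /norm2 /= expr0n addr0 ltr01.
have [org _] := hval_surj n0.
split.
- exact: hform_pos.
- exact: hform_det.
- by move=> a b [].
- move=> a b [d [l [g [hl dg rE]]]]; split.
    by rewrite (_ : det2 b a = - det2 a b) ?oppr_eq0 // /det2; ring.
  exists l, g; split=> //; rewrite -rE; apply/seteqP.
  by split=> z /= <-; rewrite /bil; ring.
- move=> k a b k0 [d [l [g [hl dg rE]]]]; split.
    rewrite (_ : det2 _ b = k * det2 a b); first by rewrite mulf_neq0.
    by rewrite /det2 /=; ring.
  have bE (Y : R * R * R) : bil Y (k * a.1, k * a.2) b = k * bil Y a b by rewrite /bil /=; ring.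
  exists l, g; split=> //; rewrite -rE; apply/seteqP; split=> z /=; rewrite bE.
    by move/eqP; rewrite mulf_eq0 (negbTE k0) => /eqP.
  by move=> ->; rewrite mulr0.
- exact: leaves_do_not_cross.
- move=> a b [_ [l [g [_ _ rE]]]]; exists (g (gm l 0)).
  by have : range (g \o gm l) (g (gm l 0)) by [exists 0]; rewrite -rE.
- exact: deck_group_comp.
- exact: deck_group_inv.
- move=> g dg; have [m1 [m2 [dm hm]]] := disk_isometry_form (Giso g dg).
  exists m1, m2; split=> // a b [d [l [h [hl dh rE]]]]; split.
    by rewrite det2_lmap dm mul1r.
  (* The matrix describes the preimage of a leaf under [g], hence the inverse [f]. *)
  have [f [df gf fg]] := deck_group_inv dg.
  exists l, (f \o h); split=> //; first exact: deck_group_comp.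
  apply/seteqP; split=> [z /=|_ [s _ <-] /=]; rewrite -hm.
    move=> hz; have [s _ hs] : range (h \o gm l) (g z) by rewrite -rE.
    by exists s => //=; move: hs => /= ->.
  by have : range (h \o gm l) (h (gm l s)) by [exists s]; rewrite -rE /= fg.
- move=> a b z1 z2 e lab e0.
  apply: (@endpoint_limit _ _ org) => //; first by case: lab.
  (* A point of the leaf is a deck translate of a point in the convex hull of the limit set, and the
     orbit hull is invariant. *)
  move=> z hz; have [y hy pyz] := core _ (leaf_sub_support gmP lab hz).
  have [g dg <-] := fibers _ _ pyz.
  apply: orbit_hull_invariant => //; [exact: deck_group_comp|exact: Giso|].
  exact: convex_hull_sub_orbit_hull.
(* [p] is injective on a sheet around [z0] and takes the same value at [g z0] and [z0]. *)
- move=> z0; have [V [W [Vz _ inj _]]] := covering_lifts cov (erefl (p z0)).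
  have [e e0 he] := nbhs_hplane Vz; exists e => // g [_ pg] h.
  apply: inj; [exact: he|exact: nbhs_singleton|].
  exact: (congr1 (fun f => f z0) pg).
Qed.

Lemma lamination_nowhere_dense (R : realType) (X : riemannSurface R) (p : hplane R -> X)
    (lam : geodesic_lamination p) :
  hyperbolic_universal_covering p -> gl_support lam `<=` convex_core p ->
  nowhere_dense (gl_support lam).
Proof.
move=> p_cov core; have [[pc ps _] _ _] := p_cov.
rewrite /nowhere_dense -(closure_id _).1; last exact: gl_closed.
apply/eqP/negPn/negP => /set0P[x xint].
have [z0 _ pz0] : range p x by rewrite ps.
have ex l : exists gam : R -> hplane R, gl_leaves lam l ->
    [/\ geodesic_line gam, simple_curve (p \o gam) & l = range (p \o gam)].
  (* Sets that are not leaves get a constant default. *)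
  have [hl|nl] := pselect (gl_leaves lam l); last by exists (fun=> z0).
  by have [c [[gam gg ->] sc lE]] := gl_geodesic hl; exists gam.
have [gm gmP] := choice ex.
have ns := lamination_noncrossing_system p_cov core gmP.
have : nbhs z0 (p @^-1` (gl_support lam)) by apply: pc; rewrite pz0.
move=> /nbhs_hplane[e e0 he].
(* All points of a neighborhood of [z0] project into the lamination, so they lie on lifted
   leaves. *)
apply: (leaves_have_empty_interior ns e0 (hform_pos z0) (hform_det z0)) => Y Y0 Y1 hY.
have [z zE] := hform_surj Y0 Y1; rewrite -zE in hY *.
exact: (leaf_through p_cov gmP (he z hY)).
Qed.

Theorem theorem1p1 (R : realType) (X : riemannSurface R) (p : hplane R -> X)
    (p_cov : hyperbolic_universal_covering p) (X_inf : infinite_surface p) :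
  (forall lam : geodesic_lamination p,
     gl_support lam `<=` convex_core p -> nowhere_dense (gl_support lam)) /\
  (convex_core p = [set: X] ->
     forall lam : geodesic_lamination p, nowhere_dense (gl_support lam)).
Proof.
split=> [lam|coreT lam]; first exact: lamination_nowhere_dense.
by apply: lamination_nowhere_dense => //; rewrite coreT.
Qed.
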